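(* Let $\mathcal O$ be an absolutely pseudo-cellular DG-operad of length $\alpha$ over a commutative ring $\Bbbk$, with $\mathcal O_{\beta+1}=\mathcal O_\beta\amalg_{\partial_\beta}\mathcal F(V_\beta)$, such that the sequence $V_\beta$ is concentrated in arities $0$ and $1$ for every $\beta<\alpha$. Let $(I\mathcal O,i_0,i_1,p,h_{\mathcal O})$ be its canonical strong pseudo-cylinder. Then for any $x\in\mathcal O(1)$ and any $y\in\mathcal O$, $$h_{\mathcal O}i_1(x\circ_1y)=h_{\mathcal O}i_1(x)\circ_1i_1(y)+(-1)^{|x|}i_0(x)\circ_1h_{\mathcal O}i_1(y).$$
   Context: Conventions. $\Bbbk$ is a commutative ring; graded modules are $\mathbb Z$-graded $\Bbbk$-modules, differentials have degree $-1$, and tensor products use the Koszul sign rule. The suspension $\Sigma X$ of a chain complex has $(\Sigma X)_n=X_{n-1}$, $d_{\Sigma X}=-d_X$, and $\sigma\colon X\to\Sigma X$ is the degree $+1$ map which is the identity degreewise. A ''sequence'' is a family indexed by arity $n\geq 0$; constructions and maps on sequences are aritywise. Operads. All operads are non-symmetric, with arities $n\ge 0$. A graded operad $\mathcal O=\{\mathcal O(n)\}_{n\geq0}$ has compositions $\circ_i\colon\mathcal O(p)\otimes\mathcal O(q)\to\mathcal O(p+q-1)$, $1\le i\le p$, and $\mathrm{id}\in\mathcal O(1)_0$, with $x\circ_i(y\circ_jz)=(x\circ_iy)\circ_{i+j-1}z$; $(x\circ_iy)\circ_jz=(-1)^{|y||z|}(x\circ_jz)\circ_{i+n-1}y$ for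 $j<i$, $z\in\mathcal O(n)$; $\mathrm{id}\circ_1x=x=x\circ_i\mathrm{id}$. A DG-operad moreover has a differential with $d(x\circ_iy)=d(x)\circ_iy+(-1)^{|x|}x\circ_id(y)$. The initial DG-operad is $\Bbbk\cdot\mathrm{id}$ in arity $1$. Strong pseudo-cylinders. A strong pseudo-cylinder $(C,i_0,i_1,p,h)$ of a chain complex $X$ consists of chain maps $i_0,i_1\colon X\to C$, $p\colon C\to X$ and a degree $+1$ map $h\colon C\to C$ with $i_0p-1_C=dh+hd$, $pi_0=pi_1=1_X$, $ph=0$, $hi_0=0$, $h^2=0$. The canonical one is $IX=X\oplus\Sigma X\oplus X$, where $i_0,i_1$ are the inclusions of the first and third summands, $d(\sigma x)=i_0x-i_1x-\sigma d(x)$, $p(i_0x)=p(i_1x)=x$, $p(\sigma x)=0$, with homotopy $h_I(i_1x)=\sigma x$, $h_I(i_0x)=h_I(\sigma x)=0$. A strong pseudo-cylinder of a DG-operad $\mathcal O$ is a DG-operad $\mathcal P$ with DG-operad maps $i_0,i_1\colon\mathcal O\to\mathcal P$, $p\colon\mathcal P\to\mathcal O$ and a sequence of degree $+1$ maps $h_{\mathcal O}\colon\mathcal P\to\mathcal P$ which aritywise form a strong pseudo-cylinder of chain complexes. Trees and coproducts. A tree is a planted planar tree with leaves; its inner vertices (those other than the bottom vertex of the root edge and the top vertices of the leaves) are ordered by the path order: $v\le w$ if the path from the root to $v$ is contained in the path to $w$ or branches off to the left of it. Levels count distance from the bottom of the root edge, so the bottommost inner vertex has level $1$; a leaf has the level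 of its top vertex. The arity $\tilde v$ of an inner vertex $v$ is the number of edges adjacent from above. $\mathcal F(V)$ is the free operad on a sequence $V$. The coproduct of operads decomposes as $(\mathcal O\amalg\mathcal F(V))(n)=\bigoplus_T(\mathcal O,V)(T)$, over trees $T$ with $n$ leaves, all of even level, where $(\mathcal O,V)(T)$ is the tensor product, in the path order, of $\mathcal O(\tilde u)$ for $u$ inner of odd level and $V(\tilde v)$ for $v$ inner of even level; a tensor (labeled tree) corresponds to the iterated composition of its labels nested according to $T$ and written in the path order. If $(\mathcal P,i_0,i_1,p,h_{\mathcal O})$ is a strong pseudo-cylinder of $\mathcal O$, then $h_{\mathcal O,V}$ is the degree $+1$ self-map of $\mathcal P\amalg\mathcal F(IV)$ preserving each summand $(\mathcal P,IV)(T)$ and given there, on a tensor $y_1\otimes\cdots\otimes y_m$ of labels in path order, by $\sum_{k=1}^m(-1)^{|y_1|+\cdots+|y_{k-1}|}i_0p(y_1)\otimes\cdots\otimes i_0p(y_{k-1})\otimes h(y_k)\otimes y_{k+1}\otimes\cdots\otimes y_m$, where $h$ is $h_{\mathcal O}$ on labels in $\mathcal P$ and $h_I$ on labels in $IV$. Twisted coproducts and induced cylinders. For a degree $-1$ map of sequences $\partial\colon V\to\mathcal O$ with $\partial d_V+d_{\mathcal O}\partial=0$, the twisted coproduct $\mathcal O\amalg_\partial\mathcal F(V)$ is $\mathcal O\amalg\mathcal F(V)$ as a graded operad, with differential extending $d_{\mathcal O}$ and equal to $d_V+\partial$ on $V$. The extension of $\partial$ to $\mathcal O\amalg\mathcal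 F(V)$ is the unique degree $-1$ self-map vanishing on $\mathcal O$, equal to $\partial$ on $V$, and satisfying the operadic Leibniz rule. Given a strong pseudo-cylinder $(\mathcal P,i_0,i_1,p,h_{\mathcal O})$ of $\mathcal O$, the canonical induced strong pseudo-cylinder of $\mathcal O\amalg_\partial\mathcal F(V)$ is $\mathcal P\amalg_{\partial_I}\mathcal F(IV)$ with $\partial_I(i_0x)=i_0\partial(x)$, $\partial_I(\sigma x)=-h_{\mathcal O}i_1\partial(x)$, $\partial_I(i_1x)=i_1\partial(x)$ for $x\in V$, structure maps $i_0\amalg\mathcal F(i_0)$, $i_1\amalg\mathcal F(i_1)$, $p\amalg\mathcal F(p)$, and homotopy $h_\partial=\sum_{n\ge0}(h_{\mathcal O,V}\partial_I)^nh_{\mathcal O,V}$ (a locally finite sum, with $\partial_I$ extended to $\mathcal P\amalg\mathcal F(IV)$). Pseudo-cellular DG-operads. $\mathcal O$ is relatively pseudo-cellular of length an ordinal $\alpha$ if it has an increasing filtration $\{\mathcal O_\beta\}_{\beta\le\alpha}$ by DG-operads with $\mathcal O_\alpha=\mathcal O$, $\mathcal O_\beta=\mathrm{colim}_{\gamma<\beta}\mathcal O_\gamma$ for limit $\beta\le\alpha$, and $\mathcal O_{\beta+1}=\mathcal O_\beta\amalg_{\partial_\beta}\mathcal F(V_\beta)$ (for some sequence of chain complexes $V_\beta$ and some $\partial_\beta$) whenever $\beta+1\le\alpha$. It is absolutely pseudo-cellular if moreover $\mathcal O_0$ is the initial DG-operad. Its canonical strong pseudo-cylinder $(I\mathcal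 O,i_0,i_1,p,h_{\mathcal O})$ is defined by induction on $\alpha$: for $\alpha=0$ it is the trivial one ($I\mathcal O=\mathcal O$, $i_0=i_1=p=1$, $h_{\mathcal O}=0$); for limit $\alpha$ it is the colimit of those of $\mathcal O_\beta$, $\beta<\alpha$; for $\alpha=\beta+1$ it is the canonical induced strong pseudo-cylinder of $\mathcal O_\beta\amalg_{\partial_\beta}\mathcal F(V_\beta)$ obtained from that of $\mathcal O_\beta$. *)

(* Defs.v *)
From HB Require Import structures.
From mathcomp Require Import all_boot all_order all_algebra.

Set Implicit Arguments.
Unset Strict Implicit.
Unset Printing Implicit Defensive.

Import Order.TTheory GRing.Theory.
Local Open Scope ring_scope.

(** * Sequences of graded modules and of chain complexes

    [X n a] is the component of arity [n] and degree [a]; elements are thus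
    always homogeneous.  Operations that change arities or degrees take the
    arity or degree of the result as an extra index, together with a proof of
    the relevant equation.  The equations are between elements of [nat] and
    [int], so the choice of their proofs is immaterial. *)

Notation gseq k := (nat -> int -> lmodType k).

Definition smap (k : comPzRingType) (X Y : gseq k) : Type :=
  forall (n : nat) (a : int), {linear X n a -> Y n a}.

(* Maps of sequences of degree [e]. *)
Definition dmap (k : comPzRingType) (e : int) (X Y : gseq k) : Type :=
  forall (n : nat) (a b : int), b = a + e -> {linear X n a -> Y n b}.

Record dgseq (k : comPzRingType) := Dgseq {
  dgs_car :> gseq k;
  dgs_diff : dmap (-1) dgs_car dgs_car;
  dgs_diffK : forall n (a b c : int) (Hb : b = a + -1) (Hc : c = b + -1)
    (x : dgs_car n a), dgs_diff n Hc (dgs_diff n Hb x) = 0 }.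
Arguments dgs_diff {k} d n {a b}.

Definition chain_map (k : comPzRingType) (X Y : dgseq k) (f : smap X Y) : Prop :=
  forall n (a b : int) (H : b = a + -1) (x : X n a),
    f n b (dgs_diff X n H x) = dgs_diff Y n H (f n a x).

Definition ksign (k : comPzRingType) (a : int) : k := (-1) ^+ `|a|%N.

(** * Strong pseudo-cylinders of (sequences of) chain complexes *)

Record strong_pseudo_cylinder (k : comPzRingType) (X C : dgseq k)
    (i0 i1 : smap X C) (p : smap C X) (h : dmap 1 C C) : Prop := {
  spc_i0 : chain_map i0;
  spc_i1 : chain_map i1;
  spc_p : chain_map p;
  spc_homotopy : forall n (a b c : int) (Hb : b = a + 1) (Hb' : a = b + -1)
    (Hc : c = a + -1) (Hc' : a = c + 1) (z : C n a),
    i0 n a (p n a z) - z =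
    dgs_diff C n Hb' (h n a b Hb z) + h n c a Hc' (dgs_diff C n Hc z);
  spc_pi0 : forall n a (x : X n a), p n a (i0 n a x) = x;
  spc_pi1 : forall n a (x : X n a), p n a (i1 n a x) = x;
  spc_ph : forall n (a b : int) (H : b = a + 1) (z : C n a),
    p n b (h n a b H z) = 0;
  spc_hi0 : forall n (a b : int) (H : b = a + 1) (x : X n a),
    h n a b H (i0 n a x) = 0;
  spc_hh : forall n (a b c : int) (Hb : b = a + 1) (Hc : c = b + 1) (z : C n a),
    h n b c Hc (h n a b Hb z) = 0 }.

Definition mk_linear (k : comPzRingType) (U V : lmodType k) (f : U -> V)
    (Hf : linear f) : {linear U -> V} :=
  HB.pack f (GRing.isLinear.Build k U V _ f Hf).

Lemma id_linear (k : comPzRingType) (U : lmodType k) : linear (@id U).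
Proof. by []. Qed.

Definition deg_cast (k : comPzRingType) (X : gseq k) n (a b : int) (H : a = b) :
    {linear X n a -> X n b} :=
  match H in _ = b return {linear X n a -> X n b} with
  | erefl => mk_linear (@id_linear k (X n a)) end.

Lemma deg_castK (k : comPzRingType) (X : gseq k) n (a b : int) (H : a = b)
    (H' : b = a) (x : X n a) : deg_cast X n H' (deg_cast X n H x) = x.
Proof. by case: b / H H' => H'; rewrite (eq_irrelevance H' erefl). Qed.

Lemma deg_cast_id (k : comPzRingType) (X : gseq k) n (a : int) (H : a = a)
    (x : X n a) : deg_cast X n H x = x.
Proof. by rewrite (eq_irrelevance H erefl). Qed.

Lemma dgs_diff_cast (k : comPzRingType) (V : dgseq k) n (a a' b b' : int)
    (e : a = a') (e' : b = b') (H : b = a + -1) (H' : b' = a' + -1)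
    (x : V n a) :
  dgs_diff V n H' (deg_cast V n e x) = deg_cast V n e' (dgs_diff V n H x).
Proof. by subst a' b'; rewrite (eq_irrelevance H' H). Qed.

Lemma cyl_diff_deg (a b : int) : b = a + -1 -> b + -1 = a + -1 + -1.
Proof. by move->. Qed.

Lemma cyl_h_deg (a b : int) : b = a + 1 -> a = b + -1.
Proof. by move->; rewrite addrK. Qed.

Lemma cyl_bd_deg (b : int) : b = b + -1 + 1.
Proof. by rewrite subrK. Qed.

Section CanonicalCylinder.
Context (k : comPzRingType) (V : dgseq k).

(* A triple [(x, s, y)] of degree [a] stands for [i0 x + sigma s + i1 y]; the
   entry [s] has degree [a - 1] in [V]. *)
Definition cyl_car : gseq k :=
  fun n a => (V n a * V n (a + -1)%R * V n a)%type : lmodType k.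

Definition cyl_diff_fun n (a b : int) (H : b = a + -1)
    (z : cyl_car n a) : cyl_car n b :=
  (dgs_diff V n H z.1.1 + deg_cast V n (esym H) z.1.2,
   - dgs_diff V n (cyl_diff_deg H) z.1.2,
   dgs_diff V n H z.2 - deg_cast V n (esym H) z.1.2).

Lemma cyl_diff_linear n (a b : int) (H : b = a + -1) :
  linear (@cyl_diff_fun n a b H).
Proof.
move=> c [[x s] y] [[x' s'] y']; rewrite /cyl_diff_fun /= !linearP /=.
congr (_, _, _); rewrite /= ?scalerDr ?scalerN ?opprD -?addrA; congr (_ + _).
- by rewrite addrCA.
- by rewrite addrCA.
Qed.

Definition cyl_diff : dmap (-1) cyl_car cyl_car :=
  fun n a b H => mk_linear (@cyl_diff_linear n a b H).

Lemma cyl_diffK n (a b c : int) (Hb : b = a + -1) (Hc : c = b + -1)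
  (z : cyl_car n a) : cyl_diff n Hc (cyl_diff n Hb z) = 0.
Proof.
case: z => [[x s] y]; subst c; subst b; rewrite /cyl_diff /= /cyl_diff_fun /=.
rewrite (eq_irrelevance (cyl_diff_deg _) erefl).
rewrite linearB linearD linearN /= !dgs_diffK sub0r add0r.
by rewrite !opprK addrN addNr.
Qed.

Definition cyl_seq : dgseq k := Dgseq cyl_diffK.

Lemma cyl_i0_linear n a :
  linear (fun x : V n a => (x, 0, 0) : cyl_car n a).
Proof.
by move=> c x y; congr (_, _, _); rewrite /= ?scaler0 ?addr0.
Qed.

Lemma cyl_i1_linear n a :
  linear (fun x : V n a => (0, 0, x) : cyl_car n a).
Proof.
by move=> c x y; congr (_, _, _); rewrite /= ?scaler0 ?addr0.
Qed.

Lemma cyl_p_linear n a : linear (fun z : cyl_car n a => z.1.1 + z.2).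
Proof.
by move=> c [[x s] y] [[x' s'] y'] /=; rewrite scalerDr addrACA.
Qed.

Lemma cyl_h_linear n (a b : int) (H : b = a + 1) :
  linear (fun z : cyl_car n a =>
            (0, deg_cast V n (cyl_h_deg H) z.2, 0) : cyl_car n b).
Proof.
move=> c [[x s] y] [[x' s'] y'] /=; rewrite linearP.
by congr (_, _, _); rewrite /= ?scaler0 ?addr0.
Qed.

Definition cyl_i0 : smap V cyl_seq := fun n a => mk_linear (@cyl_i0_linear n a).
Definition cyl_i1 : smap V cyl_seq := fun n a => mk_linear (@cyl_i1_linear n a).
Definition cyl_p : smap cyl_seq V := fun n a => mk_linear (@cyl_p_linear n a).
Definition cyl_h : dmap 1 cyl_seq cyl_seq :=
  fun n a b H => mk_linear (@cyl_h_linear n a b H).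

Lemma cyl_spc : strong_pseudo_cylinder cyl_i0 cyl_i1 cyl_p cyl_h.
Proof.
split.
- move=> n a b H x; rewrite /= /cyl_diff_fun /= !linear0 !(addr0, subr0, oppr0).
  by [].
- move=> n a b H x; rewrite /= /cyl_diff_fun /= !linear0 !(addr0, subr0, oppr0).
  by [].
- move=> n a b H [[x s] y]; rewrite /= linearD.
  by rewrite addrACA addrN addr0.
- move=> n a b c Hb Hb' Hc Hc' [[x s] y]; subst b; subst c.
  rewrite /= /cyl_diff_fun /= !linear0 !add0r.
  congr (_, _, _); rewrite /= ?addr0 ?sub0r.
  + by rewrite addrAC addrN add0r deg_castK.
  + rewrite linearD linearN /= addrA.
    rewrite (dgs_diff_cast _ (cyl_h_deg Hc') erefl) addNr add0r.
    by rewrite deg_cast_id.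
  + by rewrite deg_castK.
- by move=> n a x; rewrite /= addr0.
- by move=> n a x; rewrite /= add0r.
- by move=> n a b H z; rewrite /= addr0.
- by move=> n a b H x; rewrite /= linear0.
- by move=> n a b c Hb Hc z; rewrite /= linear0.
Qed.

End CanonicalCylinder.

(** * Non-symmetric operads

    Positions are counted from 0: the composition of [x] and [y] along a proof
    of [comp_ok p q r a b c i] is the operation x o_(i+1) y, with [x] of arity
    [p] and degree [a] and [y] of arity [q] and degree [b]; the result is of
    arity [r = p + q - 1] and degree [c = a + b]. *)

Definition comp_ok (p q r : nat) (a b c : int) (i : nat) : bool :=
  [&& (i < p)%N, (p + q == r.+1)%N & c == a + b].

Record operad (k : comPzRingType) := Operad {
  op_car :> nat -> int -> lmodType k;
  op_id : op_car 1%N 0;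
  op_comp : forall p q r a b c i, comp_ok p q r a b c i ->
    op_car p a -> op_car q b -> op_car r c;
  op_comp_linl : forall p q r a b c i (H : comp_ok p q r a b c i) y,
    linear (fun x => op_comp H x y);
  op_comp_linr : forall p q r a b c i (H : comp_ok p q r a b c i) x,
    linear (op_comp H x);
  op_compA : forall p q r pq qr pqr a b c ab bc abc i j
    (H1 : comp_ok q r qr b c bc j) (H2 : comp_ok p qr pqr a bc abc i)
    (H3 : comp_ok p q pq a b ab i) (H4 : comp_ok pq r pqr ab c abc (i + j)%N)
    x y z,
    op_comp H2 x (op_comp H1 y z) = op_comp H4 (op_comp H3 x y) z;
  op_compC : forall p q r pq pr pqr a b c ab ac abc i j
    (H1 : comp_ok p q pq a b ab i) (H2 : comp_ok pq r pqr ab c abc j)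
    (H3 : comp_ok p r pr a c ac j)
    (H4 : comp_ok pr q pqr ac b abc (i + r).-1)
    x y z, (j < i)%N ->
    op_comp H2 (op_comp H1 x y) z =
    ksign k (b * c) *: op_comp H4 (op_comp H3 x z) y;
  op_idl : forall n a (H : comp_ok 1 n n 0 a a 0) x, op_comp H op_id x = x;
  op_idr : forall n a i (H : comp_ok n 1 n a 0 a i) x,
    op_comp H x op_id = x }.
Arguments op_id {k} o.
Arguments op_comp {k} o {p q r a b c i}.

Definition operad_map (k : comPzRingType) (O P : operad k) (f : smap O P) : Prop :=
  f 1%N 0 (op_id O) = op_id P /\
  forall p q r a b c i (H : comp_ok p q r a b c i) (x : O p a) (y : O q b),
    f r c (op_comp O H x y) = op_comp P H (f p a x) (f q b y).

Definition operad_leibniz (k : comPzRingType) (O : operad k)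
    (D : dmap (-1) O O) : Prop :=
  forall p q r a b c i a' b' c'
    (Ha : a' = a + -1) (Hb : b' = b + -1) (Hc : c' = c + -1)
    (H : comp_ok p q r a b c i) (H1 : comp_ok p q r a' b c' i)
    (H2 : comp_ok p q r a b' c' i) (x : O p a) (y : O q b),
    D r c c' Hc (op_comp O H x y) =
    op_comp O H1 (D p a a' Ha x) y + ksign k a *: op_comp O H2 x (D q b b' Hb y).

Record dg_operad (k : comPzRingType) := DgOperad {
  dgo_op :> operad k;
  dgo_diff : dmap (-1) dgo_op dgo_op;
  dgo_diffK : forall n (a b c : int) (Hb : b = a + -1) (Hc : c = b + -1)
    (x : dgo_op n a), dgo_diff n Hc (dgo_diff n Hb x) = 0;
  dgo_leibniz : operad_leibniz dgo_diff }.
Arguments dgo_diff {k} d n {a b}.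

Definition dgo_seq (k : comPzRingType) (O : dg_operad k) : dgseq k :=
  Dgseq (@dgo_diffK k O).

Definition dg_operad_map (k : comPzRingType) (O P : dg_operad k)
    (f : smap O P) : Prop :=
  operad_map f /\ @chain_map k (dgo_seq O) (dgo_seq P) f.

(* [O] is the ground ring times the identity, in arity 1 and degree 0. *)
Definition initial_dg_operad (k : comPzRingType) (O : dg_operad k) : Prop :=
  bijective (fun c : k => c *: op_id O) /\
  forall n a, (n, a) != (1%N, 0) -> forall x : O n a, x = 0.

Record op_cylinder (k : comPzRingType) (O : dg_operad k) := OpCylinder {
  oc_op :> dg_operad k;
  oc_i0 : smap O oc_op;
  oc_i1 : smap O oc_op;
  oc_p : smap oc_op O;
  oc_h : dmap 1 oc_op oc_op;
  oc_i0_map : dg_operad_map oc_i0;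
  oc_i1_map : dg_operad_map oc_i1;
  oc_p_map : dg_operad_map oc_p;
  oc_spc : @strong_pseudo_cylinder k (dgo_seq O) (dgo_seq oc_op)
    oc_i0 oc_i1 oc_p oc_h }.
Arguments oc_i0 {k O} o n a.
Arguments oc_i1 {k O} o n a.
Arguments oc_p {k O} o n a.
Arguments oc_h {k O} o n {a b}.

Definition trivial_cylinder (k : comPzRingType) (O : dg_operad k)
    (C : op_cylinder O) : Prop :=
  [/\ forall n a (x : O n a), oc_i1 C n a x = oc_i0 C n a x,
      forall n a (z : C n a), oc_i0 C n a (oc_p C n a z) = z
    & forall n (a b : int) (H : b = a + 1) (z : C n a), oc_h C n H z = 0].

(** * Free operads, coproducts and twisted coproducts *)

Definition free_operad (k : comPzRingType) (V : gseq k) (F : operad k)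
    (eta : smap V F) : Prop :=
  forall (Q : operad k) (g : smap V Q), exists u : smap F Q,
    (operad_map u /\ forall n a (v : V n a), u n a (eta n a v) = g n a v) /\
    forall u' : smap F Q,
      operad_map u' -> (forall n a (v : V n a), u' n a (eta n a v) = g n a v) ->
      forall n a (x : F n a), u' n a x = u n a x.

Definition operad_coproduct (k : comPzRingType) (O F C : operad k)
    (inl : smap O C) (inr : smap F C) : Prop :=
  [/\ operad_map inl, operad_map inr &
   forall (Q : operad k) (f : smap O Q) (g : smap F Q),
    operad_map f -> operad_map g -> exists u : smap C Q,
    [/\ operad_map u, forall n a (x : O n a), u n a (inl n a x) = f n a x
      & forall n a (y : F n a), u n a (inr n a y) = g n a y] /\
    forall u' : smap C Q, operad_map u' ->
      (forall n a (x : O n a), u' n a (inl n a x) = f n a x) ->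
      (forall n a (y : F n a), u' n a (inr n a y) = g n a y) ->
      forall n a (z : C n a), u' n a z = u n a z].

(* [C] is the coproduct of [O] and of the free operad on [V]. *)
Definition free_coproduct (k : comPzRingType) (O : operad k) (V : gseq k)
    (C : operad k) (inO : smap O C) (inV : smap V C) : Prop :=
  exists (F : operad k) (eta : smap V F) (inF : smap F C),
    [/\ free_operad eta, operad_coproduct inO inF
      & forall n a (v : V n a), inV n a v = inF n a (eta n a v)].

Record twisted_coproduct (k : comPzRingType) (O : dg_operad k) (V : dgseq k)
    (bd : dmap (-1) V O) (C : dg_operad k) (inO : smap O C) (inV : smap V C)
    : Prop := {
  tc_bd : forall n (a b c : int) (Hb : b = a + -1) (Hc : c = b + -1) (v : V n a),
    bd n b c Hc (dgs_diff V n Hb v) + dgo_diff O n Hc (bd n a b Hb v) = 0;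
  tc_coproduct : free_coproduct inO inV;
  tc_diffO : forall n (a b : int) (H : b = a + -1) (x : O n a),
    dgo_diff C n H (inO n a x) = inO n b (dgo_diff O n H x);
  tc_diffV : forall n (a b : int) (H : b = a + -1) (v : V n a),
    dgo_diff C n H (inV n a v) =
    inV n b (dgs_diff V n H v) + inO n b (bd n a b H v) }.

(* [D] is the extension of [bd] to the coproduct [C]. *)
Definition bd_extension (k : comPzRingType) (O : operad k) (V : gseq k)
    (bd : dmap (-1) V O) (C : operad k) (inO : smap O C) (inV : smap V C)
    (D : dmap (-1) C C) : Prop :=
  [/\ forall n (a b : int) (H : b = a + -1) (x : O n a), D n a b H (inO n a x) = 0,
      forall n (a b : int) (H : b = a + -1) (v : V n a),
        D n a b H (inV n a v) = inO n b (bd n a b H v)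
    & operad_leibniz D].

(** * Labeled trees

    [label P W odd] is where inner vertices take their labels: [P] at odd
    levels and [W] at even levels.

    A labeled tree is built in path order, starting with the bottommost inner
    vertex and then filling the inputs of that vertex from left to right, each
    with a leaf or with a branch.  In [ltree P W odd m i a], [odd] is the parity
    of the level of the bottommost inner vertex, [a] is the total degree of the
    labels, [m] is the number of leaves and of inputs not filled so far, and the
    first [i] of these are leaves; the [m - i] others are the unfilled inputs.
    Leaves are only attached to vertices of odd level, so that they have even
    level.  The labeled trees with [m] leaves, all of even level, that start
    at level 1 thus form the type [ltree P W true m m a]. *)

Definition label (k : comPzRingType) (P W : gseq k) (odd : bool) : gseq k :=
  if odd then P else W.

Inductive ltree (k : comPzRingType) (P W : gseq k) :
    bool -> nat -> nat -> int -> Type :=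
| Vertex (odd : bool) n a (x : label P W odd n a) : ltree P W odd n 0 a
| AddLeaf m i a : (i < m)%N ->
    ltree P W true m i a -> ltree P W true m i.+1 a
| AddBranch (odd : bool) m s m' i a b c : comp_ok m s m' a b c i ->
    ltree P W odd m i a -> ltree P W (~~ odd) s s b ->
    ltree P W odd m' (i + s) c.

(* The degrees of the labels, in path order. *)
Fixpoint label_degs (k : comPzRingType) (P W : gseq k) odd m i a
    (t : ltree P W odd m i a) : seq int :=
  match t with
  | Vertex _ _ a _ => [:: a]
  | AddLeaf _ _ _ _ t1 => label_degs t1
  | AddBranch _ _ _ _ _ _ _ _ _ t1 t2 => label_degs t1 ++ label_degs t2
  end.

Definition label_map (k : comPzRingType) (P W C : gseq k) (f : smap P C)
    (g : smap W C) (odd : bool) : smap (label P W odd) C :=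
  if odd return smap (label P W odd) C then f else g.

Fixpoint tree_eval (k : comPzRingType) (P W : gseq k) (C : operad k)
    (inP : smap P C) (inW : smap W C) odd m i a (t : ltree P W odd m i a) :
    C m a :=
  match t with
  | Vertex odd n a x => label_map inP inW odd n a x
  | AddLeaf _ _ _ _ t1 => tree_eval inP inW t1
  | AddBranch _ _ _ _ _ _ _ _ H t1 t2 =>
      op_comp C H (tree_eval inP inW t1) (tree_eval inP inW t2)
  end.

Fixpoint tree_map (k : comPzRingType) (P W : gseq k)
    (f : forall odd, smap (label P W odd) (label P W odd)) odd m i a
    (t : ltree P W odd m i a) : ltree P W odd m i a :=
  match t with
  | Vertex odd n a x => Vertex (f odd n a x)
  | AddLeaf _ _ _ H t1 => AddLeaf H (tree_map f t1)
  | AddBranch _ _ _ _ _ _ _ _ H t1 t2 =>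
      AddBranch H (tree_map f t1) (tree_map f t2)
  end.

Lemma comp_okSl p q r a b c c' i : comp_ok p q r a b c i -> c' = c + 1 ->
  comp_ok p q r (a + 1) b c' i.
Proof. by case/and3P=> Hi Hr /eqP-> ->; rewrite /comp_ok Hi Hr addrAC eqxx. Qed.

Lemma comp_okSr p q r a b c c' i : comp_ok p q r a b c i -> c' = c + 1 ->
  comp_ok p q r a (b + 1) c' i.
Proof. by case/and3P=> Hi Hr /eqP-> ->; rewrite /comp_ok Hi Hr addrA eqxx. Qed.

(* [e] is applied to the labels that strictly precede the one of index [j] in
   path order, and [h], of degree 1, to that one. *)
Fixpoint tree_homotopy_term (k : comPzRingType) (P W : gseq k)
    (e : forall odd, smap (label P W odd) (label P W odd))
    (h : forall odd, dmap 1 (label P W odd) (label P W odd))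
    (j : nat) odd m i a (t : ltree P W odd m i a) :
    forall b : int, b = a + 1 -> ltree P W odd m i b :=
  match t with
  | Vertex odd n a x => fun b Hb => Vertex (h odd n a b Hb x)
  | AddLeaf _ _ _ H t1 => fun b Hb =>
      AddLeaf H (tree_homotopy_term e h j t1 Hb)
  | AddBranch _ _ _ _ _ _ _ _ H t1 t2 => fun b Hb =>
      let j1 := size (label_degs t1) in
      if (j < j1)%N
      then AddBranch (comp_okSl H Hb) (tree_homotopy_term e h j t1 erefl) t2
      else AddBranch (comp_okSr H Hb) (tree_map e t1)
             (tree_homotopy_term e h (j - j1) t2 erefl)
  end.

(** * Induced strong pseudo-cylinders of twisted coproducts *)

Definition smap_comp (k : comPzRingType) (X Y Z : gseq k) (g : smap Y Z)
    (f : smap X Y) : smap X Z :=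
  fun n a => (g n a \o f n a : {linear X n a -> Z n a}).

Section InducedCylinder.
Context (k : comPzRingType) (O : dg_operad k) (P : op_cylinder O) (V : dgseq k).

Definition label_i0p (odd : bool) :
    smap (label P (cyl_seq V) odd) (label P (cyl_seq V) odd) :=
  if odd return smap (label P (cyl_seq V) odd) (label P (cyl_seq V) odd)
  then smap_comp (oc_i0 P) (oc_p P) else smap_comp (cyl_i0 V) (cyl_p V).

Definition label_h (odd : bool) :
    dmap 1 (label P (cyl_seq V) odd) (label P (cyl_seq V) odd) :=
  if odd return dmap 1 (label P (cyl_seq V) odd) (label P (cyl_seq V) odd)
  then @oc_h k O P else cyl_h V.

(* The labeled trees span the coproduct [C], so this determines [hV]. *)
Definition tree_homotopy (C : operad k) (inP : smap P C)
    (inIV : smap (cyl_seq V) C) (hV : dmap 1 C C) : Prop :=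
  forall m (a b : int) (H : b = a + 1) (t : ltree P (cyl_seq V) true m m a),
    hV m a b H (tree_eval inP inIV t) =
    \sum_(j < size (label_degs t))
      ksign k (\sum_(e <- take j (label_degs t)) e) *:
      tree_eval inP inIV (tree_homotopy_term label_i0p label_h j t H).

Definition cyl_bd_fun (bd : dmap (-1) V O) n (a b : int) (H : b = a + -1)
    (z : cyl_seq V n a) : P n b :=
  oc_i0 P n b (bd n a b H z.1.1)
  - oc_h P n (cyl_bd_deg b)
      (oc_i1 P n (b + -1) (bd n (a + -1) (b + -1) (cyl_diff_deg H) z.1.2))
  + oc_i1 P n b (bd n a b H z.2).

Lemma cyl_bd_linear (bd : dmap (-1) V O) n (a b : int) (H : b = a + -1) :
  linear (@cyl_bd_fun bd n a b H).
Proof.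
move=> c [[x s] y] [[x' s'] y']; rewrite /cyl_bd_fun /= !linearP /=.
rewrite !scalerDr; move: (c *: _) (c *: _) (c *: _) => C B A.
by rewrite (addrACA A) (addrACA (A + B)).
Qed.

Definition cyl_bd (bd : dmap (-1) V O) : dmap (-1) (cyl_seq V) P :=
  fun n a b H => mk_linear (@cyl_bd_linear bd n a b H).
End InducedCylinder.

(* [h'] is the locally finite sum of the maps (h D)^j h, for j >= 0. *)
Definition perturbed_homotopy (k : comPzRingType) (C : gseq k)
    (h : dmap 1 C C) (D : dmap (-1) C C) (h' : dmap 1 C C) : Prop :=
  forall n (a b : int) (H : b = a + 1) (z : C n a),
    let term j :=
      iter j (fun w : C n b => h n (b + -1) b (cyl_bd_deg b)
                                 (D n b (b + -1) erefl w)) (h n a b H z) in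
    exists N : nat,
      (forall j, (N <= j)%N -> term j = 0) /\ h' n a b H z = \sum_(j < N) term j.

(* [P'] is the canonical strong pseudo-cylinder of the twisted coproduct [O']
   of [O] and [V] along [bd] that is induced by the cylinder [P] of [O]. *)
Record induced_cylinder (k : comPzRingType) (O : dg_operad k) (V : dgseq k)
    (bd : dmap (-1) V O) (O' : dg_operad k) (inO : smap O O') (inV : smap V O')
    (P : op_cylinder O) (P' : op_cylinder O') (inP : smap P P')
    (inIV : smap (cyl_seq V) P') : Prop := {
  ic_coproduct : twisted_coproduct (cyl_bd P bd) inP inIV;
  ic_i0O : forall n a (x : O n a),
    oc_i0 P' n a (inO n a x) = inP n a (oc_i0 P n a x);
  ic_i0V : forall n a (v : V n a),
    oc_i0 P' n a (inV n a v) = inIV n a (cyl_i0 V n a v);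
  ic_i1O : forall n a (x : O n a),
    oc_i1 P' n a (inO n a x) = inP n a (oc_i1 P n a x);
  ic_i1V : forall n a (v : V n a),
    oc_i1 P' n a (inV n a v) = inIV n a (cyl_i1 V n a v);
  ic_pP : forall n a (y : P n a),
    oc_p P' n a (inP n a y) = inO n a (oc_p P n a y);
  ic_pIV : forall n a (w : cyl_seq V n a),
    oc_p P' n a (inIV n a w) = inV n a (cyl_p V n a w);
  ic_h : exists (hV : dmap 1 P' P') (D : dmap (-1) P' P'),
    [/\ tree_homotopy inP inIV hV, bd_extension (cyl_bd P bd) inP inIV D
      & perturbed_homotopy hV D (@oc_h k O' P')] }.

(** * Pseudo-cellular DG-operads

    The ordinals [b] with [b <= alpha] are represented by the elements of a
    well-ordered type with a largest element [\top], which stands for [alpha]. *)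

Definition is_succ (disp : Order.disp_t) (W : tbOrderType disp) (b c : W) : Prop :=
  (b < c)%O /\ forall e : W, (e < c)%O -> (e <= b)%O.

Definition is_limit (disp : Order.disp_t) (W : tbOrderType disp) (c : W) : Prop :=
  c <> \bot%O /\ forall b : W, ~ is_succ b c.

(* A functor from [W] to DG-operads. *)
Record dg_system (k : comPzRingType) (disp : Order.disp_t)
    (W : tbOrderType disp) (S : W -> dg_operad k) := DgSystem {
  sys_map :> forall b c : W, (b <= c)%O -> smap (S b) (S c);
  sys_map_dg : forall b c (H : (b <= c)%O), dg_operad_map (sys_map H);
  sys_map_id : forall b (H : (b <= b)%O) n a (x : S b n a),
    sys_map H n a x = x;
  sys_map_comp : forall b c e (H1 : (b <= c)%O) (H2 : (c <= e)%O)
    (H : (b <= e)%O) n a (x : S b n a),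
    sys_map H n a x = sys_map H2 n a (sys_map H1 n a x) }.
Arguments sys_map {k disp W S} d {b c} H n a.

(* [S c] is the colimit of the [S b] with [b < c], among DG-operads. *)
Definition colimit_below (k : comPzRingType) (disp : Order.disp_t)
    (W : tbOrderType disp) (S : W -> dg_operad k) (j : dg_system S) (c : W)
    : Prop :=
  forall (Q : dg_operad k) (f : forall b : W, (b < c)%O -> smap (S b) Q),
    (forall b (H : (b < c)%O), dg_operad_map (f b H)) ->
    (forall b b' (H : (b < c)%O) (H' : (b' < c)%O) (Hb : (b <= b')%O) n a
       (x : S b n a), f b' H' n a (sys_map j Hb n a x) = f b H n a x) ->
    exists u : smap (S c) Q,
      (dg_operad_map u /\
       forall b (H : (b < c)%O) n a (x : S b n a),
         u n a (sys_map j (ltW H) n a x) = f b H n a x) /\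
      forall u' : smap (S c) Q, dg_operad_map u' ->
        (forall b (H : (b < c)%O) n a (x : S b n a),
           u' n a (sys_map j (ltW H) n a x) = f b H n a x) ->
        forall n a (z : S c n a), u' n a z = u n a z.

(* The DG-operad [pc_op \top] is relatively pseudo-cellular of length [\top].
   The values of [pc_V] and [pc_bd] at [\top], and of [pc_in b c] when [c] is
   not the successor of [b], are irrelevant. *)
Record pseudo_cellular (k : comPzRingType) (disp : Order.disp_t)
    (W : tbOrderType disp) := PseudoCellular {
  pc_op :> W -> dg_operad k;
  pc_sys : dg_system pc_op;
  pc_inj : forall b c (H : (b <= c)%O) n a, injective (sys_map pc_sys H n a);
  pc_V : W -> dgseq k;
  pc_bd : forall b : W, dmap (-1) (pc_V b) (pc_op b);
  pc_in : forall b c : W, smap (pc_V b) (pc_op c);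
  pc_succ : forall b c (H : is_succ b c),
    twisted_coproduct (pc_bd b) (sys_map pc_sys (ltW (proj1 H))) (pc_in b c);
  pc_limit : forall c, is_limit c -> colimit_below pc_sys c }.
Arguments pc_sys {k disp W} p.
Arguments pc_V {k disp W} p b.
Arguments pc_bd {k disp W} p b.
Arguments pc_in {k disp W} p b c.

Definition absolutely_pseudo_cellular (k : comPzRingType) (disp : Order.disp_t)
    (W : tbOrderType disp) (F : pseudo_cellular k W) : Prop :=
  initial_dg_operad (F \bot%O).

(* The canonical strong pseudo-cylinders of all the stages of the filtration;
   that of the whole operad is [cc_cyl \top].  Like the coproducts and the
   colimits they are made of, they are only specified up to isomorphism. *)
Record canonical_cylinder (k : comPzRingType) (disp : Order.disp_t)
    (W : tbOrderType disp) (F : pseudo_cellular k W) := CanonicalCylinder {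
  cc_cyl :> forall b : W, op_cylinder (F b);
  cc_sys : dg_system (fun b => oc_op (cc_cyl b));
  cc_in : forall b c : W, smap (cyl_seq (pc_V F b)) (cc_cyl c);
  cc_bot : trivial_cylinder (cc_cyl \bot%O);
  cc_succ : forall b c (H : is_succ b c),
    induced_cylinder (pc_bd F b)
      (sys_map (pc_sys F) (ltW (proj1 H))) (pc_in F b c)
      (P := cc_cyl b) (P' := cc_cyl c)
      (sys_map cc_sys (ltW (proj1 H))) (cc_in b c);
  cc_limit : forall c, is_limit c -> colimit_below cc_sys c;
  cc_limit_i0 : forall b c (H : (b < c)%O), is_limit c ->
    forall n a (x : F b n a),
    oc_i0 (cc_cyl c) n a (sys_map (pc_sys F) (ltW H) n a x) =
    sys_map cc_sys (ltW H) n a (oc_i0 (cc_cyl b) n a x);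
  cc_limit_i1 : forall b c (H : (b < c)%O), is_limit c ->
    forall n a (x : F b n a),
    oc_i1 (cc_cyl c) n a (sys_map (pc_sys F) (ltW H) n a x) =
    sys_map cc_sys (ltW H) n a (oc_i1 (cc_cyl b) n a x);
  cc_limit_p : forall b c (H : (b < c)%O), is_limit c ->
    forall n a (z : cc_cyl b n a),
    oc_p (cc_cyl c) n a (sys_map cc_sys (ltW H) n a z) =
    sys_map (pc_sys F) (ltW H) n a (oc_p (cc_cyl b) n a z);
  cc_limit_h : forall b c (H : (b < c)%O), is_limit c ->
    forall n a a' (Ha : a' = a + 1) (z : cc_cyl b n a),
    oc_h (cc_cyl c) n Ha (sys_map cc_sys (ltW H) n a z) =
    sys_map cc_sys (ltW H) n a' (oc_h (cc_cyl b) n Ha z) }.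

(* Main.v *)
(* When all the [V_beta] live in arities 0 and 1, so do [O] and [I O]: these are
   an algebra in arity 1 and a left module in arity 0.  The identity of the
   theorem then holds for all x and y in [I O], not only for those in the image
   of i1: h is a derivation twisted by i0 p,
     h(x o y) = h(x) o y + (-1)^|x| i0 p(x) o h(y).
   This is inherited along the filtration.  At a successor stage the labeled
   trees are words, so the map H = h_(O,V) is a twisted derivation as soon as
   that of the previous stage is one.  If delta is a twisted derivation with
   p delta = 0 and H delta = 0, then so is H D delta for the Leibniz extension
   D of the attaching map, because D preserves both the image of i0 and the
   kernel of p; hence all terms of sum_n (H D)^n H are twisted derivations. *)

Require Import Defs.
From HB Require Import structures.
From mathcomp Require Import all_boot all_order all_algebra.
From mathcomp Require Import boolp zify.

Set Implicit Arguments.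
Unset Strict Implicit.
Unset Printing Implicit Defensive.

Import Order.TTheory GRing.Theory.
Local Open Scope ring_scope.

(** * Koszul signs and bilinearity of composition *)

Section Signs.
Context (k : comPzRingType).

Lemma ksign0 : ksign k 0 = 1.
Proof. by []. Qed.

(** Signs see only the parity of the absolute value, and parity is additive on integers. *)
Lemma ksignD a b : ksign k (a + b) = ksign k a * ksign k b.
Proof.
rewrite /ksign -exprD -[LHS]signr_odd -[RHS]signr_odd; congr (_ ^+ _).
by rewrite oddD; case: a b => [m|m] [n|n]; lia.
Qed.

Lemma ksignMM a : ksign k a * ksign k a = 1.
Proof. by rewrite /ksign -exprD addnn -mul2n exprM sqrrN expr1n expr1n. Qed.

End Signs.

Section Composition.
Context (k : comPzRingType) (C : operad k) (p q r : nat) (a b c : int) (i : nat).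
Context (H : comp_ok p q r a b c i).
Implicit Types (x : C p a) (y : C q b).

Lemma op_compDl x x' y : op_comp C H (x + x') y = op_comp C H x y + op_comp C H x' y.
Proof. exact: (linearD (mk_linear (op_comp_linl H y))). Qed.

Lemma op_compDr x y y' : op_comp C H x (y + y') = op_comp C H x y + op_comp C H x y'.
Proof. exact: (linearD (mk_linear (op_comp_linr H x))). Qed.

Lemma op_compZl d x y : op_comp C H (d *: x) y = d *: op_comp C H x y.
Proof. exact: (linearZ_LR (mk_linear (op_comp_linl H y))). Qed.

Lemma op_compZr d x y : op_comp C H x (d *: y) = d *: op_comp C H x y.
Proof. exact: (linearZ_LR (mk_linear (op_comp_linr H x))). Qed.

Lemma op_comp0l y : op_comp C H 0 y = 0.
Proof. exact: (linear0 (mk_linear (op_comp_linl H y))). Qed.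

Lemma op_comp0r x : op_comp C H x 0 = 0.
Proof. exact: (linear0 (mk_linear (op_comp_linr H x))). Qed.

Lemma op_comp_suml (J : Type) (s : seq J) (X : J -> C p a) y :
  op_comp C H (\sum_(j <- s) X j) y = \sum_(j <- s) op_comp C H (X j) y.
Proof. exact: (linear_sum (mk_linear (op_comp_linl H y))). Qed.

Lemma op_comp_sumr (J : Type) (s : seq J) x (Y : J -> C q b) :
  op_comp C H x (\sum_(j <- s) Y j) = \sum_(j <- s) op_comp C H x (Y j).
Proof. exact: (linear_sum (mk_linear (op_comp_linr H x))). Qed.

End Composition.

(** * Suboperads and DG-suboperads cut out by a predicate *)

Section SubOperad.
Context (k : comPzRingType) (C : operad k) (S : forall n a, C n a -> Prop).

Record op_closed : Prop := {
  opc_0 : forall n a, S (0 : C n a);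
  opc_lin : forall n a d (x y : C n a), S x -> S y -> S (d *: x + y);
  opc_id : S (op_id C);
  opc_comp : forall p q r a b c i (H : comp_ok p q r a b c i) x y,
    S x -> S y -> S (op_comp C H x y) }.

(** Classical reflection turns [S] into the boolean predicate from which the subtype and its module
    structure are built. *)
Definition sub_pred n a : {pred C n a} := fun x => `[< S x >].

Context (Scl : op_closed).

Lemma sub_pred_submod n a : submod_closed (@sub_pred n a).
Proof.
split; first by apply/asboolP/(opc_0 Scl).
by move=> d x y /asboolP Sx /asboolP Sy; apply/asboolP/(opc_lin Scl).
Qed.

Definition sub_submod n a : submodClosed (C n a) :=
  HB.pack (@sub_pred n a) (GRing.isSubmodClosed.Build k _ _ (@sub_pred_submod n a)).

Record sub_elt n a := SubElt { sub_val : C n a; _ : sub_val \in sub_submod n a }.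
HB.instance Definition _ n a := [isSub for @sub_val n a].
HB.instance Definition _ n a := [Choice of @sub_elt n a by <:].
HB.instance Definition _ n a := [SubChoice_isSubLmodule of @sub_elt n a by <:].

Definition sub_car n a : lmodType k := @sub_elt n a.

Definition sub_mk n a (x : C n a) (Sx : S x) : sub_car n a :=
  SubElt (introT (asboolP _) Sx).

Lemma sub_valP n a (x : sub_car n a) : S (sub_val x).
Proof. by case: x => x /= /asboolP. Qed.

Lemma sub_inj n a (x y : sub_car n a) : sub_val x = sub_val y -> x = y.
Proof. exact: val_inj. Qed.

Lemma sub_val_linear n a : linear (@sub_val n a : sub_car n a -> C n a).
Proof. by []. Qed.

Definition sub_incl : smap sub_car C := fun n a => mk_linear (@sub_val_linear n a).

Definition sub_comp p q r a b c i (H : comp_ok p q r a b c i)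
    (x : sub_car p a) (y : sub_car q b) : sub_car r c :=
  sub_mk (opc_comp Scl H (sub_valP x) (sub_valP y)).

Definition sub_operad : operad k.
Proof.
refine (@Operad k sub_car (sub_mk (opc_id Scl)) sub_comp _ _ _ _ _ _).
- by move=> p q r a b c i H y d x x'; apply: sub_inj; rewrite /= op_compDl op_compZl.
- by move=> p q r a b c i H x d y y'; apply: sub_inj; rewrite /= op_compDr op_compZr.
- by move=> p q r pq qr pqr a b c ab bc abc i j H1 H2 H3 H4 x y z;
    apply: sub_inj; apply: op_compA.
- by move=> p q r pq pr pqr a b c ab ac abc i j H1 H2 H3 H4 x y z lt_ji;
    apply: sub_inj; apply: op_compC.
- by move=> n a H x; apply: sub_inj; apply: op_idl.
- by move=> n a i H x; apply: sub_inj; apply: op_idr.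
Defined.

Section Corestriction.
Context (X : gseq k) (f : smap X C) (Sf : forall n a (x : X n a), S (f n a x)).

Lemma corestr_linear n a : linear (fun x : X n a => sub_mk (Sf x)).
Proof. by move=> d x y; apply: sub_inj; rewrite /= linearP. Qed.

Definition corestr : smap X sub_operad := fun n a => mk_linear (@corestr_linear n a).

End Corestriction.

Lemma corestr_map (X : operad k) (f : smap X C) Sf :
  operad_map f -> operad_map (@corestr X f Sf).
Proof.
case=> f1 fM; split; first by apply: sub_inj; rewrite /= f1.
by move=> *; apply: sub_inj; rewrite /= fM.
Qed.

End SubOperad.

Section SubDgOperad.
Context (k : comPzRingType) (C : dg_operad k) (S : forall n a, C n a -> Prop).
Context (Scl : op_closed S).
Context (Sd : forall n (a b : int) (H : b = a + -1) (x : C n a),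
  S x -> S (dgo_diff C n H x)).

Definition sub_diff_fun n (a b : int) (H : b = a + -1) (x : sub_operad Scl n a) :
  sub_operad Scl n b := sub_mk Scl (Sd H (sub_valP x)).

Lemma sub_diff_linear n (a b : int) (H : b = a + -1) : linear (@sub_diff_fun n a b H).
Proof. by move=> d x y; apply: sub_inj; rewrite /= linearP. Qed.

Definition sub_dg_operad : dg_operad k.
Proof.
refine (@DgOperad k (sub_operad Scl)
  (fun n a b H => mk_linear (@sub_diff_linear n a b H)) _ _).
- by move=> n a b c Hb Hc x; apply: sub_inj; rewrite /= dgo_diffK.
- move=> p q r a b c i a' b' c' Ha Hb Hc H H1 H2 x y; apply: sub_inj.
  exact: dgo_leibniz.
Defined.

End SubDgOperad.

(** * Induction principles drawn from universal properties *)

Lemma free_operad_ind (k : comPzRingType) (V : gseq k) (F : operad k)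
    (eta : smap V F) (S : forall n a, F n a -> Prop) :
  free_operad eta -> op_closed S -> (forall n a v, S n a (eta n a v)) ->
  forall n a (x : F n a), S n a x.
Proof.
move=> Ffree Scl SV n a x.
(* The generators factor through the suboperad [S]. The induced map [u] followed by the inclusion,
   and the identity, both extend [eta]; uniqueness makes them equal, so every element lies in
   [S]. *)
have [u [[uM uV] _]] := Ffree _ (corestr Scl SV).
have [u0 [_ u0_uniq]] := Ffree F eta.
have valM : @operad_map _ F F (smap_comp (sub_incl Scl) u).
  split; first by rewrite /= uM.1.
  by move=> p q r b c d i H y z; rewrite /= uM.2.
have -> : x = sub_val (u n a x).
  transitivity (u0 n a x).
    by apply: (u0_uniq (fun m b => mk_linear (@id_linear k (F m b)))).
  by symmetry; apply: (u0_uniq _ valM) => m b v; rewrite /= uV.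
exact: sub_valP.
Qed.

Lemma free_coproduct_ind (k : comPzRingType) (O : operad k) (V : gseq k)
    (C : operad k) (inO : smap O C) (inV : smap V C)
    (S : forall n a, C n a -> Prop) :
    free_coproduct inO inV ->
    (forall n a d (x y : C n a), S n a x -> S n a y -> S n a (d *: x + y)) ->
    (forall n a x, S n a (inO n a x)) -> (forall n a v, S n a (inV n a v)) ->
    (forall p q r a b c i (H : comp_ok p q r a b c i) x y,
       S p a x -> S q b y -> S r c (op_comp C H x y)) ->
  forall n a (x : C n a), S n a x.
Proof.
move=> [F [eta [inF [Ffree [inOM inFM Cuniv] inVE]]]] Slin SO SV Scomp.
(* Zero and the identity are images under [inO], hence lie in [S]. *)
have S0 n a : S n a 0 by rewrite -(linear0 (inO n a)); apply: SO.
have Scl : op_closed S by split => //; rewrite -inOM.1; apply: SO.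
have SF n a (f : F n a) : S n a (inF n a f).
  apply: (@free_operad_ind _ _ _ _ (fun n a f => S n a (inF n a f)) Ffree).
    split=> [m b|m b d y z Sy Sz||p q r b c d i H y z Sy Sz].
    - by rewrite linear0.
    - by rewrite linearP; apply: Slin.
    - by rewrite inFM.1; apply: opc_id Scl.
    - by rewrite inFM.2; apply: Scomp.
  by move=> m b v; rewrite -inVE.
move=> n a x.
have [u [[uM uO uF] _]] :=
  Cuniv _ _ _ (corestr_map Scl SO inOM) (corestr_map Scl SF inFM).
have [u0 [_ u0_uniq]] := Cuniv C inO inF inOM inFM.
have valM : @operad_map _ C C (smap_comp (sub_incl Scl) u).
  split; first by rewrite /= uM.1.
  by move=> p q r b c d i H y z; rewrite /= uM.2.
have -> : x = sub_val (u n a x).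
  transitivity (u0 n a x).
    by apply: (u0_uniq (fun m b => mk_linear (@id_linear k (C m b)))).
  by symmetry; apply: (u0_uniq _ valM) => m b y; rewrite /= ?uO ?uF.
exact: sub_valP.
Qed.

(** The images of the earlier stages form an increasing union, which is a DG-suboperad; the
    universal property then forces it to be everything, as for the free operad. *)
Lemma colimit_below_surj (k : comPzRingType) (disp : Order.disp_t)
    (W : tbOrderType disp) (S : W -> dg_operad k) (j : dg_system S) (c : W) :
  c <> \bot%O -> colimit_below j c ->
  forall n a (z : S c n a),
  exists b (H : (b < c)%O) (x : S b n a), z = sys_map j (ltW H) n a x.
Proof.
move=> c_bot Scolim.
pose T n a (z : S c n a) :=
  exists b (H : (b < c)%O) (x : S b n a), z = sys_map j (ltW H) n a x.
have Tj b (H : (b < c)%O) n a (x : S b n a) : T n a (sys_map j (ltW H) n a x).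
  by exists b, H, x.
(* The order is total, so two elements can be represented at a common stage. *)
have T2 m n a d (y : S c m a) (z : S c n d) : T m a y -> T n d z ->
    exists b (H : (b < c)%O) y' z',
    y = sys_map j (ltW H) m a y' /\ z = sys_map j (ltW H) n d z'.
  move=> [b [Hb [y' ->]]] [b' [Hb' [z' ->]]]; case: (leP b b') => [le_bb'|/ltW le_b'b].
    exists b', Hb', (sys_map j le_bb' m a y'), z'; split=> //; exact: sys_map_comp.
  exists b, Hb, y', (sys_map j le_b'b n d z'); split=> //; exact: sys_map_comp.
(* The bottom stage lies below [c] and supplies zero and the identity. *)
have lt0c : (\bot < c)%O by rewrite lt_def Order.le0x andbT; apply/eqP.
have Tcl : op_closed T.
  split=> [n a|n a d x y Tx Ty||p q r a b e i H x y Tx Ty].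
  - by exists \bot%O, lt0c, 0; rewrite linear0.
  - have [b [H [x' [y' [-> ->]]]]] := T2 _ _ _ _ _ _ Tx Ty.
    by exists b, H, (d *: x' + y'); rewrite linearP.
  - by exists \bot%O, lt0c, (op_id _); rewrite (sys_map_dg j (ltW lt0c)).1.1.
  - have [f [Hf [x' [y' [-> ->]]]]] := T2 _ _ _ _ _ _ Tx Ty.
    by exists f, Hf, (op_comp _ H x' y'); rewrite (sys_map_dg j (ltW Hf)).1.2.
have Td n (a b : int) (H : b = a + -1) x : T n a x -> T n b (dgo_diff (S c) n H x).
  move=> [f [Hf [x' ->]]]; exists f, Hf, (dgo_diff (S f) n H x').
  by rewrite (sys_map_dg j (ltW Hf)).2.
pose Q := sub_dg_operad Tcl Td.
pose f b (H : (b < c)%O) : smap (S b) Q := corestr Tcl (Tj b H).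
have fM b (H : (b < c)%O) : dg_operad_map (f b H).
  split; first exact: (corestr_map Tcl (Tj b H) (sys_map_dg j (ltW H)).1).
  by move=> n a d Hd x; apply: sub_inj; apply: (sys_map_dg j (ltW H)).2.
have fc b b' (H : (b < c)%O) (H' : (b' < c)%O) (Hb : (b <= b')%O) n a (x : S b n a) :
    f b' H' n a (sys_map j Hb n a x) = f b H n a x.
  by apply: sub_inj; symmetry; apply: sys_map_comp.
have [u [[uM uf] _]] := Scolim Q f fM fc.
have [u0 [_ u0_uniq]] := Scolim (S c) (fun b H => sys_map j (ltW H))
  (fun b H => sys_map_dg j (ltW H))
  (fun b b' H H' Hb n a x => esym (sys_map_comp j Hb (ltW H') (ltW H) x)).
have valM : @dg_operad_map _ (S c) (S c) (smap_comp (sub_incl Tcl) u).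
  split; last by move=> n a b H x; rewrite /= uM.2.
  split; first by rewrite /= uM.1.1.
  by move=> p q r b d e i H y z; rewrite /= uM.1.2.
move=> n a z.
have -> : z = sub_val (u n a z).
  transitivity (u0 n a z).
    by apply: (u0_uniq (fun m b => mk_linear (@id_linear k (S c m b)))).
  by symmetry; apply: (u0_uniq _ valM) => b H m d y; rewrite /= uf.
exact: (sub_valP (u n a z)).
Qed.

(** * Perturbation of twisted derivations *)

Section Perturbation.
Context (k : comPzRingType) (C : operad k) (e : smap C C).

(** Plain functions, so that the composites of [h] and [D] can be written directly with [iter]. *)
Definition hmap := forall n (a b : int), b = a + 1 -> C n a -> C n b.

Definition twisted_derivation (h : hmap) : Prop :=
  forall p q r a b c i a' b' c' (Ha : a' = a + 1) (Hb : b' = b + 1) (Hc : c' = c + 1)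
    (H : comp_ok p q r a b c i) (H1 : comp_ok p q r a' b c' i)
    (H2 : comp_ok p q r a b' c' i) (x : C p a) (y : C q b),
  h r c c' Hc (op_comp C H x y) =
  op_comp C H1 (h p a a' Ha x) y + ksign k a *: op_comp C H2 (e p a x) (h q b b' Hb y).

Context (h : dmap 1 C C) (D : dmap (-1) C C).
Context (ee : forall n a (x : C n a), e n a (e n a x) = e n a x).
Context (hder : twisted_derivation h) (DL : operad_leibniz D).
Context (he : forall n (a b : int) (H : b = a + 1) x, h n H (e n a x) = 0).
Context (hh : forall n (a b c : int) (H : b = a + 1) (H' : c = b + 1) x,
  h n H' (h n H x) = 0).
Context (eh : forall n (a b : int) (H : b = a + 1) x, e n b (h n H x) = 0).
Context (De : forall n (a b : int) (H : b = a + -1) x,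
  D n H (e n a x) = e n b (D n H (e n a x))).
Context (eD : forall n (a b : int) (H : b = a + -1) x,
  e n b (D n H x) = e n b (D n H (e n a x))).

(** Expanding [h D d] on a composite by the three Leibniz rules gives eight terms. Six contain one
    of the zero maps [e D d], [h d], [e d], [h D e], [h e]; the two that remain are the claim. *)
Lemma perturb_step (d : hmap) :
    twisted_derivation d ->
    (forall n (a b : int) (H : b = a + 1) x, e n b (d n a b H x) = 0) ->
    (forall n (a b c : int) (H : b = a + 1) (H' : c = b + 1) x,
       h n H' (d n a b H x) = 0) ->
  twisted_derivation (fun n a b H x =>
    h n (cyl_bd_deg b) (@D n b (b + -1) erefl (d n a b H x))).
Proof.
move=> dder ed hd p q r a b c i a' b' c' Ha Hb Hc H H1 H2 x y.
(* Here [e D d = e D e d], and [e d = 0]. *)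
have eDd n f g (Hg : g = f + 1) z : e n (g + -1) (@D n g (g + -1) erefl (d n f g Hg z)) = 0.
  by rewrite eD ed !linear0.
(* Here [h D e = h e D e], and [h e = 0]. *)
have hDe n f (z : C n f) : h n (cyl_bd_deg f) (@D n f (f + -1) erefl (e n f z)) = 0.
  by rewrite De he.
have ok f g l : f + g = l -> comp_ok p q r f g l i.
  by move: H => /and3P[Hi Hr _] <-; rewrite /comp_ok Hi Hr eqxx.
have Ec : c = a + b by case/and3P: H => _ _ /eqP.
have K1 : comp_ok p q r (a' + -1) b (c' + -1) i by apply: ok; lia.
have K2 : comp_ok p q r a' (b + -1) (c' + -1) i by apply: ok; lia.
have K3 : comp_ok p q r (a + -1) b' (c' + -1) i by apply: ok; lia.
have K4 : comp_ok p q r a (b' + -1) (c' + -1) i by apply: ok; lia.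
have K5 : comp_ok p q r (a' + 1) (b + -1) c' i by apply: ok; lia.
have K6 : comp_ok p q r (a + -1) (b' + 1) c' i by apply: ok; lia.
have K7 : comp_ok p q r (a' + -1) (b + 1) c' i by apply: ok; lia.
have K8 : comp_ok p q r (a + 1) (b' + -1) c' i by apply: ok; lia.
rewrite (dder _ _ _ _ _ _ _ _ _ _ Ha Hb Hc H H1 H2) linearD linearZ_LR /=.
rewrite (DL erefl erefl erefl H1 K1 K2) (DL erefl erefl erefl H2 K3 K4).
rewrite !(linearD, linearZ_LR) /=.
rewrite (hder (cyl_bd_deg a') erefl (cyl_bd_deg c') K1 H1 K7) eDd op_comp0l scaler0.
rewrite (hder erefl (cyl_bd_deg b) (cyl_bd_deg c') K2 K5 H1) hd ed !op_comp0l.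
rewrite (hder (cyl_bd_deg a) erefl (cyl_bd_deg c') K3 H2 K6) hDe hd op_comp0l op_comp0r.
rewrite (hder erefl (cyl_bd_deg b') (cyl_bd_deg c') K4 K8 H2) he ee op_comp0l.
by rewrite !(scaler0, addr0, add0r) !scalerA ksignMM mul1r.
Qed.

(** The sums at [x], at [y] and at their composite stop at different bounds. Later terms vanish, so
    all three can be taken up to the largest bound, and the rule holds term by term. *)
Lemma perturbed_derivation (h' : dmap 1 C C) :
  perturbed_homotopy h D h' -> twisted_derivation h'.
Proof.
move=> hh'.
pose K n b (w : C n b) := h n (cyl_bd_deg b) (@D n b (b + -1) erefl w).
pose d j : hmap := fun n a b H x => iter j (@K n b) (h n H x).
have [dder ed hd]: [/\ forall j, twisted_derivation (d j),
    forall j n (a b : int) (H : b = a + 1) x, e n b (d j n a b H x) = 0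
  & forall j n (a b c : int) (H : b = a + 1) (H' : c = b + 1) x,
       h n H' (d j n a b H x) = 0].
  suff step j : [/\ twisted_derivation (d j),
      forall n (a b : int) (H : b = a + 1) x, e n b (d j n a b H x) = 0
    & forall n (a b c : int) (H : b = a + 1) (H' : c = b + 1) x,
         h n H' (d j n a b H x) = 0].
    by split=> j; case: (step j).
  (* The outermost map of every iterate is [h], so [e h = 0] and [h h = 0] give the last two
     claims. *)
  elim: j => [|j [dder ed hd]]; first by [].
  by split=> [|n a b H x|n a b c H H' x]; [exact: perturb_step|exact: eh|exact: hh].
have h'E n a b (H : b = a + 1) x : exists N, forall M, (N <= M)%N ->
    h' n a b H x = \sum_(j < M) d j n a b H x.
  have [N [dN ->]] := hh' n a b H x; exists N => M le_NM.
  rewrite -!(big_mkord xpredT (fun j => d j n a b H x)) [RHS](big_cat_nat (n := N)) //=.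
  rewrite -[LHS]addr0; congr (_ + _); symmetry.
  by rewrite big_nat_cond big1 // => j /andP[/andP[/dN]].
move=> p q r a b c i a' b' c' Ha Hb Hc H H1 H2 x y.
have [N1 E1] := h'E _ _ _ Ha x; have [N2 E2] := h'E _ _ _ Hb y.
have [N3 E3] := h'E _ _ _ Hc (op_comp C H x y).
pose N := maxn N1 (maxn N2 N3).
rewrite (E1 N) ?(E2 N) ?(E3 N) ?/N ?leq_max ?leqnn ?orbT //.
rewrite op_comp_suml op_comp_sumr scaler_sumr -big_split /=.
by apply: eq_bigr => j _; apply: dder.
Qed.

End Perturbation.

(** * Homotopies on labeled trees *)

Section TreeHomotopy.
Context (k : comPzRingType) (P W : gseq k) (C : operad k).
Context (inP : smap P C) (inW : smap W C).
Context (e : forall odd, smap (label P W odd) (label P W odd)).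
Context (h : forall odd, dmap 1 (label P W odd) (label P W odd)).

(** The sum that prescribes [hV], extended to trees with a root of either parity and with unfilled
    inputs, so that it can be computed along the construction of a tree. *)
Definition tree_homotopy_sum odd m i a (t : ltree P W odd m i a) b (Hb : b = a + 1) : C m b :=
  \sum_(j < size (label_degs t)) ksign k (\sum_(d <- take j (label_degs t)) d) *:
    tree_eval inP inW (tree_homotopy_term e h j t Hb).

Lemma sum_label_degs odd m i a (t : ltree P W odd m i a) :
  \sum_(d <- label_degs t) d = a.
Proof.
elim: t => {odd m i a} /= [odd n a _|m i a _ t IH|odd m s m' i a b c H t1 IH1 t2 IH2] //.
  by rewrite big_seq1.
by rewrite big_cat /= IH1 IH2; case/and3P: H => _ _ /eqP.
Qed.

Lemma tree_homotopy_sum_vertex odd n a (x : label P W odd n a) b (Hb : b = a + 1) :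
  tree_homotopy_sum (Vertex x) Hb = label_map inP inW odd n b (h odd n Hb x).
Proof. by rewrite /tree_homotopy_sum big_ord1 /= big_nil ksign0 scale1r. Qed.

(** The labels of [t1] all precede those of [t2] in path order. The sum therefore splits in two, and
    in the second half every label of [t1] is hit by [e] and their total degree [a] enters the
    sign. *)
Lemma tree_homotopy_sum_branch odd m s m' i a b c a' b' c'
    (Ha : a' = a + 1) (Hb : b' = b + 1) (Hc : c' = c + 1)
    (H : comp_ok m s m' a b c i) (H1 : comp_ok m s m' a' b c' i)
    (H2 : comp_ok m s m' a b' c' i)
    (t1 : ltree P W odd m i a) (t2 : ltree P W (~~ odd) s s b) :
  tree_homotopy_sum (AddBranch H t1 t2) Hc =
  op_comp C H1 (tree_homotopy_sum t1 Ha) (tree_eval inP inW t2) +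
  ksign k a *: op_comp C H2 (tree_eval inP inW (tree_map e t1)) (tree_homotopy_sum t2 Hb).
Proof.
subst a' b'; rewrite (bool_irrelevance H1 (comp_okSl H Hc)).
rewrite (bool_irrelevance H2 (comp_okSr H Hc)) /tree_homotopy_sum /= size_cat.
rewrite big_split_ord /= op_comp_suml op_comp_sumr scaler_sumr; congr (_ + _).
  apply: eq_bigr => j _ /=.
  by rewrite ltn_ord takel_cat ?(ltnW (ltn_ord j)) // op_compZl.
apply: eq_bigr => j _ /=; rewrite ltnNge leq_addr /= addKn op_compZr scalerA.
by rewrite takeD take_size_cat // drop_size_cat // big_cat /= sum_label_degs ksignD.
Qed.

End TreeHomotopy.

(** * Operads in arities 0 and 1 *)

Definition arity_le1 (k : comPzRingType) (X : gseq k) :=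
  forall n a (x : X n a), (1 < n)%N -> x = 0.

Lemma comp_ok_unary q r a b c i : comp_ok 1 q r a b c i -> [/\ i = 0%N, r = q & c = a + b].
Proof.
case/and3P; rewrite ltnS leqn0 add1n eqSS => /eqP-> /eqP-> /eqP->.
by split.
Qed.

Lemma comp_ok1 n a b c : a + b = c -> comp_ok 1 n n a b c 0.
Proof. by move=> <-; rewrite /comp_ok add1n !eqxx. Qed.

(** As [p + q = r + 1], a composite of arity above 1 has a factor of arity above 1, which
    vanishes. *)
Lemma operad_arity_le1 (k : comPzRingType) (O : operad k) (V : gseq k)
    (C : operad k) (inO : smap O C) (inV : smap V C) :
  free_coproduct inO inV -> arity_le1 O -> arity_le1 V -> arity_le1 C.
Proof.
move=> CP O1 V1 n a x; move: n a x.
apply: (free_coproduct_ind CP).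
- by move=> n a d x y Sx Sy n1; rewrite Sx // Sy // scaler0 addr0.
- by move=> n a x /(O1 _ _ x)->; rewrite linear0.
- by move=> n a x /(V1 _ _ x)->; rewrite linear0.
- move=> p q r a b c i H x y Sx Sy r1; case/and3P: (H) => i_p /eqP pq _.
  case: (ltnP 1 p) => [p1|p1]; first by rewrite Sx // op_comp0l.
  by rewrite Sy ?op_comp0r //; lia.
Qed.

Lemma operad_map_free_coproduct (k : comPzRingType) (O : operad k) (V : gseq k)
    (C : operad k) (inO : smap O C) (inV : smap V C) :
  free_coproduct inO inV -> operad_map inO.
Proof. by case=> F [eta [inF [_ [] ]]]. Qed.

Lemma operad_map_comp (k : comPzRingType) (A B C : operad k) (g : smap B C) (f : smap A B) :
  operad_map g -> operad_map f -> operad_map (smap_comp g f).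
Proof.
move=> [g1 gM] [f1 fM]; split; first by rewrite /= f1.
by move=> *; rewrite /= fM gM.
Qed.

Section DerivationAt.
Context (k : comPzRingType) (C : operad k) (e : smap C C) (h : dmap 1 C C).

(** The twisted Leibniz rule at a single pair, so that it can be propagated from generators in each
    argument separately. *)
Definition derivation_at p a (x : C p a) q b (y : C q b) : Prop :=
  forall r c i a' b' c' (Ha : a' = a + 1) (Hb : b' = b + 1) (Hc : c' = c + 1)
    (H : comp_ok p q r a b c i) (H1 : comp_ok p q r a' b c' i)
    (H2 : comp_ok p q r a b' c' i),
  h r Hc (op_comp C H x y) =
  op_comp C H1 (h p Ha x) y + ksign k a *: op_comp C H2 (e p a x) (h q Hb y).

Lemma derivation_at_linl p a (x x' : C p a) q b (y : C q b) d :
  derivation_at x y -> derivation_at x' y -> derivation_at (d *: x + x') y.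
Proof.
move=> Dx Dx' r c i a' b' c' Ha Hb Hc H H1 H2.
rewrite !linearP !op_compDl !op_compZl linearP /=.
rewrite (Dx _ _ _ _ _ _ Ha Hb Hc H H1 H2) (Dx' _ _ _ _ _ _ Ha Hb Hc H H1 H2).
by rewrite !scalerDr !scalerA (mulrC d) addrACA.
Qed.

Lemma derivation_at_linr p a (x : C p a) q b (y y' : C q b) d :
  derivation_at x y -> derivation_at x y' -> derivation_at x (d *: y + y').
Proof.
move=> Dy Dy' r c i a' b' c' Ha Hb Hc H H1 H2.
rewrite !linearP !op_compDr !op_compZr linearP /=.
rewrite (Dy _ _ _ _ _ _ Ha Hb Hc H H1 H2) (Dy' _ _ _ _ _ _ Ha Hb Hc H H1 H2).
by rewrite !scalerDr !scalerA (mulrC d) addrACA.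
Qed.

Lemma derivation_at_0l p a q b (y : C q b) : derivation_at (0 : C p a) y.
Proof. by move=> *; rewrite !op_comp0l !linear0 !op_comp0l scaler0 addr0. Qed.

Lemma derivation_at_0r p a q b (x : C p a) : derivation_at x (0 : C q b).
Proof. by move=> *; rewrite !op_comp0r !linear0 !op_comp0r scaler0 addr0. Qed.

Context (eM : operad_map e).

Lemma derivation_at_unary a (x : C 1%N a) n b (y : C n b) :
  (forall a' b' c c' (Ha : a' = a + 1) (Hb : b' = b + 1) (Hc : c' = c + 1)
    (H : comp_ok 1 n n a b c 0) (H1 : comp_ok 1 n n a' b c' 0)
    (H2 : comp_ok 1 n n a b' c' 0),
  h n Hc (op_comp C H x y) =
  op_comp C H1 (h 1 Ha x) y + ksign k a *: op_comp C H2 (e 1%N a x) (h n Hb y)) ->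
  derivation_at x y.
Proof.
move=> D r c i a' b' c' Ha Hb Hc H.
have [Ei Er _] := comp_ok_unary H; subst i r => H1 H2; exact: D.
Qed.

(** The defect [B] of the rule is a twisted Hochschild cocycle: [B(x x', y) + B(x, x') y] equals
    [B(x, x' y)] plus or minus [e(x) B(x', y)]. This uses that [e] is multiplicative. When three of
    the terms vanish, so does the fourth. *)
Lemma derivation_at_assocr a b n d (x : C 1%N a) (x' : C 1%N b) (y : C n d)
    ab bd (Hab : comp_ok 1 1 1 a b ab 0) (Hbd : comp_ok 1 n n b d bd 0) :
  derivation_at x x' -> derivation_at x' y -> derivation_at (op_comp C Hab x x') y ->
  derivation_at x (op_comp C Hbd x' y).
Proof.
move=> Dxx' Dx'y Dxx'y; apply: derivation_at_unary => a' bd' c c' Ha Hb Hc H H1 H2.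
have [[[_ _ Eab] [_ _ Ebd]] [_ _ Ec]] :=
  (comp_ok_unary Hab, comp_ok_unary Hbd, comp_ok_unary H).
have K1 : comp_ok 1 n n ab d c 0 by apply: comp_ok1; lia.
have K2 : comp_ok 1 n n (ab + 1) d c' 0 by apply: comp_ok1; lia.
have K3 : comp_ok 1 n n ab (d + 1) c' 0 by apply: comp_ok1; lia.
have K4 : comp_ok 1 1 1 a' b (ab + 1) 0 by apply: comp_ok1; lia.
have K5 : comp_ok 1 1 1 a (b + 1) (ab + 1) 0 by apply: comp_ok1; lia.
have K6 : comp_ok 1 n n (b + 1) d bd' 0 by apply: comp_ok1; lia.
have K7 : comp_ok 1 n n b (d + 1) bd' 0 by apply: comp_ok1; lia.
rewrite (op_compA (j := 0) Hbd H Hab K1).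
rewrite (Dxx'y _ _ _ _ _ _ erefl erefl Hc K1 K2 K3).
rewrite (Dxx' _ _ _ _ _ _ Ha erefl erefl Hab K4 K5).
rewrite (Dx'y _ _ _ _ _ _ erefl erefl Hb Hbd K6 K7) eM.2.
rewrite op_compDl op_compDr op_compZl op_compZr scalerDr scalerA -ksignD -Eab.
by rewrite !(op_compA (j := 0) Hbd H1 K4 K2) (op_compA (j := 0) K6 H2 K5 K2)
  (op_compA (j := 0) K7 H2 Hab K3) addrA.
Qed.

(** The same cocycle identity, solved for the pair [(x x', y)]. *)
Lemma derivation_at_assocl a b n d (x : C 1%N a) (x' : C 1%N b) (y : C n d)
    ab bd (Hab : comp_ok 1 1 1 a b ab 0) (Hbd : comp_ok 1 n n b d bd 0) :
  derivation_at x x' -> derivation_at x' y -> derivation_at x (op_comp C Hbd x' y) ->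
  derivation_at (op_comp C Hab x x') y.
Proof.
move=> Dxx' Dx'y Dx; apply: derivation_at_unary => ab' d' c c' Ha Hb Hc H H1 H2.
have [[[_ _ Eab] [_ _ Ebd]] [_ _ Ec]] :=
  (comp_ok_unary Hab, comp_ok_unary Hbd, comp_ok_unary H).
have K1 : comp_ok 1 n n a bd c 0 by apply: comp_ok1; lia.
have K2 : comp_ok 1 n n (a + 1) bd c' 0 by apply: comp_ok1; lia.
have K3 : comp_ok 1 n n a (bd + 1) c' 0 by apply: comp_ok1; lia.
have K4 : comp_ok 1 1 1 (a + 1) b ab' 0 by apply: comp_ok1; lia.
have K5 : comp_ok 1 1 1 a (b + 1) ab' 0 by apply: comp_ok1; lia.
have K6 : comp_ok 1 n n (b + 1) d (bd + 1) 0 by apply: comp_ok1; lia.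
have K7 : comp_ok 1 n n b d' (bd + 1) 0 by apply: comp_ok1; lia.
rewrite -(op_compA (j := 0) Hbd K1 Hab H).
rewrite (Dx _ _ _ _ _ _ erefl erefl Hc K1 K2 K3).
rewrite (Dxx' _ _ _ _ _ _ erefl erefl Ha Hab K4 K5).
rewrite (Dx'y _ _ _ _ _ _ erefl Hb erefl Hbd K6 K7) eM.2.
rewrite op_compDl op_compDr op_compZl op_compZr scalerDr scalerA -ksignD -Eab.
by rewrite !(op_compA (j := 0) Hbd K2 K4 H1) (op_compA (j := 0) K6 K3 K5 H1)
  (op_compA (j := 0) K7 K3 Hab H2) addrA.
Qed.

End DerivationAt.

(** * The induced cylinder *)

Definition cyl_i0p (k : comPzRingType) (O : dg_operad k) (P : op_cylinder O) : smap P P :=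
  smap_comp (oc_i0 P) (oc_p P).

Section CylinderI0p.
Context (k : comPzRingType) (O : dg_operad k) (P : op_cylinder O).

Lemma cyl_i0p_map : operad_map (cyl_i0p P).
Proof. exact: operad_map_comp (oc_i0_map P).1 (oc_p_map P).1. Qed.

Lemma cyl_i0pK n a (x : P n a) : cyl_i0p P n a (cyl_i0p P n a x) = cyl_i0p P n a x.
Proof. by rewrite /= (spc_pi0 (oc_spc P)). Qed.

Lemma oc_h_i0p n (a b : int) (H : b = a + 1) (x : P n a) :
  oc_h P n H (cyl_i0p P n a x) = 0.
Proof. exact: (spc_hi0 (oc_spc P)). Qed.

Lemma oc_p_h n (a b : int) (H : b = a + 1) (x : P n a) : oc_p P n b (oc_h P n H x) = 0.
Proof. exact: (spc_ph (oc_spc P)). Qed.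

Lemma oc_h_id (b : int) (H : b = 0 + 1) : oc_h P 1 H (op_id P) = 0.
Proof. by rewrite -(oc_i0_map P).1.1 (spc_hi0 (oc_spc P)). Qed.

End CylinderI0p.

Section InducedDerivation.
Context (k : comPzRingType) (O : dg_operad k) (V : dgseq k) (bd : dmap (-1) V O).
Context (O' : dg_operad k) (inO : smap O O') (inV : smap V O').
Context (P : op_cylinder O) (P' : op_cylinder O').
Context (inP : smap P P') (inIV : smap (cyl_seq V) P').
Context (IC : induced_cylinder bd inO inV inP inIV).
Context (P1 : arity_le1 P) (V1 : arity_le1 V).
Context (P_der : twisted_derivation (cyl_i0p P) (@oc_h k O P)).

Local Notation W := (cyl_seq V).
Local Notation e := (cyl_i0p P').

Let P'_coprod : free_coproduct inP inIV := tc_coproduct (ic_coproduct IC).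

Let W1 : arity_le1 W.
Proof.
by move=> n a [[x s] y] n1; rewrite (V1 x n1) (V1 s n1) (V1 y n1).
Qed.

Lemma arity_le1_induced : arity_le1 P'.
Proof. exact: operad_arity_le1 P'_coprod P1 W1. Qed.

Let inP_map : operad_map inP.
Proof. exact: operad_map_free_coproduct P'_coprod. Qed.

Let e_inP n a (x : P n a) : e n a (inP n a x) = inP n a (cyl_i0p P n a x).
Proof. by rewrite /= (ic_pP IC) (ic_i0O IC). Qed.

Let e_inIV n a (w : W n a) :
  e n a (inIV n a w) = inIV n a (cyl_i0 V n a (cyl_p V n a w)).
Proof. by rewrite /= (ic_pIV IC) (ic_i0V IC). Qed.

(** * The tree homotopy is a twisted derivation *)

Section TreeHomotopyDerivation.
Context (hV : dmap 1 P' P') (hV_tree : tree_homotopy inP inIV hV).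

Local Notation der := (derivation_at e hV).
Local Notation "[ 'Sum' t ]" :=
  (tree_homotopy_sum inP inIV (@label_i0p k O P V) (@label_h k O P V) t).

(** A nullary [u] is a complete one-vertex tree, a unary [u] becomes one after a leaf is added, and
    higher arities vanish. *)
Lemma tree_homotopy_inP n (a b : int) (H : b = a + 1) (u : P n a) :
  hV n H (inP n a u) = inP n b (oc_h P n H u).
Proof.
case: n u => [|[|n]] u; last by rewrite (P1 u) // !linear0.
  exact: etrans (hV_tree H (@Vertex k P W true 0 a u)) (tree_homotopy_sum_vertex _ _ _ _ _ _).
have hVu := hV_tree H (@AddLeaf k P W 1 0 a erefl (@Vertex k P W true 1 a u)).
exact: etrans hVu (tree_homotopy_sum_vertex inP inIV (@label_i0p k O P V)
  (@label_h k O P V) (odd := true) u H).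
Qed.

(** The formula for [hV] covers only trees rooted at level 1; placing [u] below the even-rooted [t]
    produces such a tree. *)
Let hV_branch a b c a' b' c' n (Ha : a' = a + 1) (Hb : b' = b + 1) (Hc : c' = c + 1)
    (H : comp_ok 1 n n a b c 0) (H1 : comp_ok 1 n n a' b c' 0)
    (H2 : comp_ok 1 n n a b' c' 0) (u : P 1%N a) (t : ltree P W false n n b) :
  hV n Hc (op_comp P' H (inP 1%N a u) (tree_eval inP inIV t)) =
  op_comp P' H1 (inP 1%N a' (oc_h P 1 Ha u)) (tree_eval inP inIV t) +
  ksign k a *: op_comp P' H2 (e 1%N a (inP 1%N a u)) ([Sum t] Hb).
Proof.
apply: etrans (hV_tree Hc (@AddBranch k P W true 1 n n 0 a b c H (@Vertex k P W true 1 a u) t)) _.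
apply: etrans (tree_homotopy_sum_branch _ _ _ _ Ha Hb Hc H H1 H2 _ _) _.
by rewrite (tree_homotopy_sum_vertex _ _ _ _ (odd := true)) /= -e_inP.
Qed.

(** Take [u] to be the identity in [hV_branch]: its homotopy is zero and [e] fixes it, so only the
    sum over [t] is left. *)
Let hV_false n a b (t : ltree P W false n n a) (Hb : b = a + 1) :
  hV n Hb (tree_eval inP inIV t) = [Sum t] Hb.
Proof.
have ok0 : comp_ok 1 n n 0 a a 0 by apply: comp_ok1; lia.
have ok1 : comp_ok 1 n n 1 a b 0 by apply: comp_ok1; lia.
have ok2 : comp_ok 1 n n 0 b b 0 by apply: comp_ok1; lia.
have := hV_branch erefl Hb Hb ok0 ok1 ok2 (op_id P) t.
rewrite inP_map.1 op_idl oc_h_id linear0 op_comp0l add0r ksign0 scale1r.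
by rewrite (cyl_i0p_map P').1 op_idl.
Qed.

Lemma derivation_inP_even_tree a (u : P 1%N a) n b (t : ltree P W false n n b) :
  der (inP 1%N a u) (tree_eval inP inIV t).
Proof.
apply: derivation_at_unary => a' b' c c' Ha Hb Hc H H1 H2.
by rewrite (hV_branch Ha Hb Hc H H1 H2) tree_homotopy_inP hV_false.
Qed.

Let hV_true n a b (t : ltree P W true n n a) (Hb : b = a + 1) :
  hV n Hb (tree_eval inP inIV t) = [Sum t] Hb.
Proof. exact: hV_tree. Qed.

Let Sum_inIV n a b (v : W n a) (Hb : b = a + 1) :
  [Sum @Vertex k P W false n a v] Hb = inIV n b (cyl_h V n Hb v).
Proof. exact: (tree_homotopy_sum_vertex _ _ _ _ (odd := false)). Qed.

(** [hV_false] handles the even root [v]; what stands above it is a complete odd-rooted tree, on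
    which the sum is [hV] again. *)
Let hV_inIV_tree a b c a' b' c' n (Ha : a' = a + 1) (Hb : b' = b + 1) (Hc : c' = c + 1)
    (H : comp_ok 1 n n a b c 0) (H1 : comp_ok 1 n n a' b c' 0)
    (H2 : comp_ok 1 n n a b' c' 0) (v : W 1%N a) (t : ltree P W true n n b) :
  hV n Hc (op_comp P' H (inIV 1%N a v) (tree_eval inP inIV t)) =
  op_comp P' H1 (inIV 1%N a' (cyl_h V 1 Ha v)) (tree_eval inP inIV t) +
  ksign k a *: op_comp P' H2 (e 1%N a (inIV 1%N a v)) (hV n Hb (tree_eval inP inIV t)).
Proof.
have := hV_false (@AddBranch k P W false 1 n n 0 a b c H (@Vertex k P W false 1 a v) t) Hc.
rewrite (tree_homotopy_sum_branch _ _ _ _ Ha Hb Hc H H1 H2) -hV_true Sum_inIV.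
by rewrite /= -e_inIV.
Qed.

(** Leaves sit only on vertices of odd level, so a unary [v] is completed by an identity of [P]
    carrying a leaf; [hV] vanishes on that identity. *)
Lemma tree_homotopy_inIV n (a b : int) (H : b = a + 1) (v : W n a) :
  hV n H (inIV n a v) = inIV n b (cyl_h V n H v).
Proof.
case: n v => [|[|n]] v; last by rewrite (W1 v) // !linear0.
  by have := hV_false (@Vertex k P W false 0 a v) H; rewrite Sum_inIV.
have ok0 : comp_ok 1 1 1 a 0 a 0 by apply: comp_ok1; lia.
have ok1 : comp_ok 1 1 1 b 0 b 0 by apply: comp_ok1; lia.
have ok2 : comp_ok 1 1 1 a 1 b 0 by apply: comp_ok1; lia.
have := hV_inIV_tree H erefl H ok0 ok1 ok2 v
  (@AddLeaf k P W 1 0 0 erefl (@Vertex k P W true 1 0 (op_id P))).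
have hV_id : hV 1 erefl (inP 1%N 0 (op_id P)) = 0.
  by rewrite tree_homotopy_inP oc_h_id linear0.
by rewrite /= hV_id inP_map.1 !op_idr op_comp0r scaler0 addr0.
Qed.

Lemma derivation_inIV_tree a (v : W 1%N a) n b (t : ltree P W true n n b) :
  der (inIV 1%N a v) (tree_eval inP inIV t).
Proof.
apply: derivation_at_unary => a' b' c c' Ha Hb Hc H H1 H2.
by rewrite (hV_inIV_tree Ha Hb Hc H H1 H2) tree_homotopy_inIV.
Qed.

(* The values of the labeled trees without vertices of arity greater than [1];
   they mspan [P'] since [P] and [W] vanish in arities greater than [1]. *)
Inductive monomial : forall n a, P' n a -> Prop :=
| monomial_inP n a (u : P n a) : (n <= 1)%N -> monomial (inP n a u)
| monomial_nullary a b c (H : comp_ok 1 0 0 a b c 0) (u : P 1%N a) (v : W 0%N b) :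
    monomial (op_comp P' H (inP 1%N a u) (inIV 0%N b v))
| monomial_unary n a b d f c (H : comp_ok 1 n n a f c 0) (H' : comp_ok 1 n n b d f 0)
    (u : P 1%N a) (v : W 1%N b) (z : P' n d) : monomial z ->
    monomial (op_comp P' H (inP 1%N a u) (op_comp P' H' (inIV 1%N b v) z)).

(** A monomial is a word alternating between [P] and [IV]. A final unary label in [P] receives the
    leaf; a final nullary label closes the word. *)
Lemma monomial_tree n a (z : P' n a) : monomial z ->
  exists t : ltree P W true n n a, z = tree_eval inP inIV t.
Proof.
elim=> {n a z} [[|[|n]] a u n1|a b c H u v|n a b d f c H H' u v z _ [t ->]] //.
- by exists (@Vertex k P W true 0 a u).
- by exists (@AddLeaf k P W 1 0 a erefl (@Vertex k P W true 1 a u)).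
- by exists (@AddBranch k P W true 1 0 0 0 a b c H (@Vertex k P W true 1 a u)
    (@Vertex k P W false 0 b v)).
- by exists (@AddBranch k P W true 1 n n 0 a f c H (@Vertex k P W true 1 a u)
    (@AddBranch k P W false 1 n n 0 b d f H' (@Vertex k P W false 1 b v) t)).
Qed.

(** The linear span in impredicative form, so that membership is itself the induction principle. *)
Definition mspan n a (z : P' n a) := forall S : P' n a -> Prop,
  S 0 -> (forall d x y, S x -> S y -> S (d *: x + y)) ->
  (forall x, monomial x -> S x) -> S z.

Lemma mspan_0 n a : @mspan n a 0.
Proof. by move=> S S0. Qed.

Lemma mspan_lin n a d (x y : P' n a) : mspan x -> mspan y -> mspan (d *: x + y).
Proof. by move=> Sx Sy S S0 Slin Smon; apply: (Slin); [exact: Sx|exact: Sy]. Qed.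

Lemma mspan_monomial n a (x : P' n a) : monomial x -> mspan x.
Proof. by move=> Mx S _ _; apply. Qed.

Lemma mspan_linear n a m b (f : {linear P' n a -> P' m b}) :
  (forall x, monomial x -> mspan (f x)) -> forall x, mspan x -> mspan (f x).
Proof.
move=> fM x Sx; apply: (Sx (fun y => mspan (f y))) => [|d y z Sy Sz|y /fM //].
  by rewrite linear0; apply: mspan_0.
by rewrite linearP; apply: mspan_lin.
Qed.

(** By linearity [z] is a monomial; its first label is in [P] and absorbs [u]. *)
Lemma mspan_inP_comp a (u : P 1%N a) n b c (H : comp_ok 1 n n a b c 0) (z : P' n b) :
  mspan z -> mspan (op_comp P' H (inP 1%N a u) z).
Proof.
apply: (@mspan_linear _ _ _ _ (mk_linear (op_comp_linr H _))) => {}z Mz /=.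
apply: mspan_monomial.
case: {n b z} Mz c H
  => [n b u' n1|b d e0 H' u' v|n b d f df e0 H' H'' u' v z Mz] c H.
- by rewrite -inP_map.2; apply: monomial_inP.
- have [[_ _ Eb] [_ _ Ec]] := (comp_ok_unary H', comp_ok_unary H).
  have K1 : comp_ok 1 1 1 a b (a + b) 0 by apply: comp_ok1.
  have K2 : comp_ok 1 0 0 (a + b) d c 0 by apply: comp_ok1; lia.
  by rewrite (op_compA (j := 0) H' H K1 K2) -inP_map.2; apply: monomial_nullary.
- have [[_ _ Eb] [_ _ Ec]] := (comp_ok_unary H', comp_ok_unary H).
  have K1 : comp_ok 1 1 1 a b (a + b) 0 by apply: comp_ok1.
  have K2 : comp_ok 1 n n (a + b) df c 0 by apply: comp_ok1; lia.
  by rewrite (op_compA (j := 0) H' H K1 K2) -inP_map.2; apply: monomial_unary.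
Qed.

Lemma monomial_inIV_comp a (v : W 1%N a) n b c (H : comp_ok 1 n n a b c 0) (z : P' n b) :
  monomial z -> monomial (op_comp P' H (inIV 1%N a v) z).
Proof.
move=> Mz; have K : comp_ok 1 n n 0 c c 0 by apply: comp_ok1; lia.
by rewrite -[X in monomial X](op_idl K) -inP_map.1; apply: monomial_unary.
Qed.

Lemma mspan_inIV_comp a (v : W 1%N a) n b c (H : comp_ok 1 n n a b c 0) (z : P' n b) :
  mspan z -> mspan (op_comp P' H (inIV 1%N a v) z).
Proof.
apply: (@mspan_linear _ _ _ _ (mk_linear (op_comp_linr H _))) => {}z Mz /=.
by apply: mspan_monomial; apply: monomial_inIV_comp.
Qed.

(** Identities of [P] fill the odd levels: one below [v], and one above it when [v] is unary. *)
Lemma monomial_inIV n a (v : W n a) : (n <= 1)%N -> monomial (inIV n a v).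
Proof.
case: n v => [|[|n]] v // _.
  have K : comp_ok 1 0 0 0 a a 0 by apply: comp_ok1; lia.
  by rewrite -(op_idl K (inIV _ _ v)) -inP_map.1; apply: monomial_nullary.
have K : comp_ok 1 1 1 a 0 a 0 by apply: comp_ok1; lia.
rewrite -(op_idr K (inIV _ _ v)); apply: monomial_inIV_comp.
by rewrite -inP_map.1; apply: monomial_inP.
Qed.

Lemma mspan_all n a (z : P' n a) : mspan z.
Proof.
(* The strengthened claim, that composing with [z] on the left preserves the span, passes to
   composites by associativity. *)
suff: mspan z /\ forall m b c (H : comp_ok n m m a b c 0) (y : P' m b),
  mspan y -> mspan (op_comp P' H z y) by case.
move: n a z; apply: (free_coproduct_ind P'_coprod).
- move=> n a d x y [Sx Mx] [Sy My]; split; first exact: mspan_lin.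
  move=> m b c H z Sz; rewrite op_compDl op_compZl.
  by apply: mspan_lin; [apply: Mx | apply: My].
- move=> n a x; split=> [|m b c H y Sy].
    case: (leqP n 1) => n1; first by apply: mspan_monomial; apply: monomial_inP.
    by rewrite (P1 x) // linear0; apply: mspan_0.
  case/and3P: (H) => _ /eqP En _.
  have En1 : n = 1%N by lia.
  by subst n; apply: mspan_inP_comp.
- move=> n a x; split=> [|m b c H y Sy].
    case: (leqP n 1) => n1; first by apply: mspan_monomial; apply: monomial_inIV.
    by rewrite (W1 x) // linear0; apply: mspan_0.
  case/and3P: (H) => _ /eqP En _.
  have En1 : n = 1%N by lia.
  by subst n; apply: mspan_inIV_comp.
- move=> p q r a b c i H x y [Sx Mx] [Sy My].
  have [p1|p1] := ltnP 1 p.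
    rewrite (arity_le1_induced x) // op_comp0l; split; first exact: mspan_0.
    by move=> *; rewrite op_comp0l; apply: mspan_0.
  have Ep : p = 1%N by case/and3P: (H) => *; lia.
  subst p; have [Ei Er _] := comp_ok_unary H; subst i r.
  split=> [|m d f H' z Sz]; first exact: Mx.
  have Eq : q = 1%N by case/and3P: (H') => *; lia.
  subst q; have [[_ _ Ec] [_ _ Ef]] := (comp_ok_unary H, comp_ok_unary H').
  have K1 : comp_ok 1 m m b d (b + d) 0 by apply: comp_ok1.
  have K2 : comp_ok 1 m m a (b + d) f 0 by apply: comp_ok1; lia.
  by rewrite -(op_compA (j := 0) K1 K2 H H'); apply: Mx; apply: My.
Qed.

(** Two factors in [P] are covered by [P_der]. Otherwise [z] is a label [u'] of [P] over an
    even-rooted tree, and [derivation_at_assocr] applies because the composite of [u] and [u'] is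
    again in [P]. *)
Lemma derivation_inP_monomial a (u : P 1%N a) n b (z : P' n b) :
  monomial z -> der (inP 1%N a u) z.
Proof.
have inP_der c d (u1 : P 1%N c) m (u2 : P m d) : der (inP 1%N c u1) (inP m d u2).
  apply: derivation_at_unary => a' b' f f' Ha Hb Hc H H1 H2.
  rewrite -inP_map.2 !tree_homotopy_inP (P_der Ha Hb Hc H H1 H2).
  by rewrite linearD linearZ_LR /= !inP_map.2 -e_inP.
have comp_der m d (w : P' m d) : (forall c (u1 : P 1%N c), der (inP 1%N c u1) w) ->
    forall c d' (u1 : P 1%N c) (u2 : P 1%N d') f (H : comp_ok 1 m m d' d f 0),
    der (inP 1%N c u1) (op_comp P' H (inP 1%N d' u2) w).
  move=> wder c d' u1 u2 f H.
  have K : comp_ok 1 1 1 c d' (c + d') 0 by apply: comp_ok1.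
  apply: (derivation_at_assocr (cyl_i0p_map P') (Hab := K)) => //.
  by rewrite -inP_map.2.
case=> {n b z} [n b u' n1|b d c H u' v|n b d f df c H H' u' v z /monomial_tree[t ->]].
- exact: inP_der.
- apply: comp_der => c' u1; exact: (derivation_inP_even_tree u1 (@Vertex k P W false 0 d v)).
- apply: comp_der => c' u1.
  exact: (derivation_inP_even_tree u1
    (@AddBranch k P W false 1 n n 0 d f df H' (@Vertex k P W false 1 d v) t)).
Qed.

Lemma derivation_span p a (x : P' p a) n b (z : P' n b) :
  (forall y : P' n b, monomial y -> der x y) -> der x z.
Proof.
by move=> xder; apply: (@mspan_all n b z (fun y => der x y)) => [|d y y'|//];
  [exact: derivation_at_0r|exact: derivation_at_linr].
Qed.

(** Induction on the left factor: for generators the right factor is reduced to monomials, and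
    composites follow from [derivation_at_assocl]. *)
Lemma tree_homotopy_derivation : twisted_derivation e hV.
Proof.
suff all_der n a (x : P' n a) : forall m b (y : P' m b), der x y.
  by move=> p q r a b c i a' b' c' Ha Hb Hc H H1 H2 x y; apply: all_der.
move: n a x; apply: (free_coproduct_ind P'_coprod).
- by move=> n a d x y Dx Dy m b z; apply: derivation_at_linl.
- move=> n a x m b y.
  have [n1|n1] := ltnP 1 n; first by rewrite (P1 x) // linear0; apply: derivation_at_0l.
  (* For a left factor of arity 0 the rule is vacuous, as it has no input to compose at. *)
  case: n x n1 => [|[|n]] x // _.
  by apply: derivation_span => z; apply: derivation_inP_monomial.
- move=> n a x m b y.
  have [n1|n1] := ltnP 1 n; first by rewrite (W1 x) // linear0; apply: derivation_at_0l.
  case: n x n1 => [|[|n]] x // _.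
  by apply: derivation_span => z /monomial_tree[t ->]; apply: derivation_inIV_tree.
- move=> p q r a b c i H x y Dx Dy m d z.
  have [p1|p1] := ltnP 1 p.
    by rewrite (arity_le1_induced x) // op_comp0l; apply: derivation_at_0l.
  have Ep : p = 1%N by case/and3P: (H) => *; lia.
  subst p; have [Ei Er _] := comp_ok_unary H; subst i r.
  have [q1|q1] := ltnP 1 q.
    by rewrite (arity_le1_induced y) // op_comp0r; apply: derivation_at_0l.
  case: q y Dy H q1 => [|[|q]] y Dy H // _.
  have K : comp_ok 1 m m b d (b + d) 0 by apply: comp_ok1.
  exact: (derivation_at_assocl (cyl_i0p_map P') H (Hbd := K)).
Qed.

(** * Side conditions of the tree homotopy, checked on generators and propagated by the twisted
    rule *)

Lemma tree_homotopy_i0p n (a b : int) (H : b = a + 1) (x : P' n a) :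
  hV n H (e n a x) = 0.
Proof.
move: n a x b H; apply: (free_coproduct_ind P'_coprod).
- by move=> n a d x y Hx Hy b H; rewrite !linearP Hx Hy scaler0 addr0.
- by move=> n a x b H; rewrite e_inP tree_homotopy_inP oc_h_i0p linear0.
- move=> n a w b H; rewrite e_inIV tree_homotopy_inIV.
  by rewrite (spc_hi0 (cyl_spc V)) linear0.
- move=> p q r a b c i H x y Hx Hy c' Hc.
  rewrite (cyl_i0p_map P').2.
  rewrite (tree_homotopy_derivation erefl erefl Hc H (comp_okSl H Hc) (comp_okSr H Hc)).
  by rewrite Hx Hy op_comp0l op_comp0r scaler0 addr0.
Qed.

Lemma i0p_tree_homotopy n (a b : int) (H : b = a + 1) (x : P' n a) :
  e n b (hV n H x) = 0.
Proof.
move: n a x b H; apply: (free_coproduct_ind P'_coprod).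
- by move=> n a d x y Hx Hy b H; rewrite !linearP Hx Hy scaler0 addr0.
- by move=> n a x b H; rewrite tree_homotopy_inP e_inP /= oc_p_h !linear0.
- move=> n a w b H; rewrite tree_homotopy_inIV e_inIV.
  by rewrite (spc_ph (cyl_spc V)) !linear0.
- move=> p q r a b c i H x y Hx Hy c' Hc.
  rewrite (tree_homotopy_derivation erefl erefl Hc H (comp_okSl H Hc) (comp_okSr H Hc)).
  by rewrite linearD linearZ_LR !(cyl_i0p_map P').2 Hx Hy op_comp0l op_comp0r scaler0 addr0.
Qed.

(** On a composite, the mixed terms of the double expansion contain [e hV] or [hV e], which
    vanish. *)
Lemma tree_homotopyK n (a b c : int) (H : b = a + 1) (H' : c = b + 1) (x : P' n a) :
  hV n H' (hV n H x) = 0.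
Proof.
move: n a x b c H H'; apply: (free_coproduct_ind P'_coprod).
- by move=> n a d x y Hx Hy b c H H'; rewrite !linearP Hx Hy scaler0 addr0.
- move=> n a x b c H H'; rewrite !tree_homotopy_inP.
  by rewrite (spc_hh (oc_spc P)) linear0.
- move=> n a w b c H H'; rewrite !tree_homotopy_inIV.
  by rewrite (spc_hh (cyl_spc V)) linear0.
- move=> p q r a b c i H x y Hx Hy c1 c2 Hc1 Hc2.
  have [Kl Kr] := (comp_okSl H Hc1, comp_okSr H Hc1).
  rewrite (tree_homotopy_derivation erefl erefl Hc1 H Kl Kr) linearD linearZ_LR /=.
  rewrite (tree_homotopy_derivation erefl erefl Hc2 Kl (comp_okSl Kl Hc2) (comp_okSr Kl Hc2)).
  rewrite (tree_homotopy_derivation erefl erefl Hc2 Kr (comp_okSl Kr Hc2) (comp_okSr Kr Hc2)).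
  rewrite Hx Hy i0p_tree_homotopy tree_homotopy_i0p.
  by rewrite !(op_comp0l, op_comp0r) !(scaler0, addr0).
Qed.

End TreeHomotopyDerivation.

(** * The Leibniz extension of the attaching map, compared with [e] *)

Section TwistingDifferential.
Context (D : dmap (-1) P' P') (D_ext : bd_extension (cyl_bd P bd) inP inIV D).

Let D_inP n a b (H : b = a + -1) x : D n H (inP n a x) = 0.
Proof. by case: D_ext. Qed.

Let D_inIV n a b (H : b = a + -1) w : D n H (inIV n a w) = inP n b (cyl_bd P bd n H w).
Proof. by case: D_ext. Qed.

Let D_leibniz : operad_leibniz D. Proof. by case: D_ext. Qed.

Let cyl_bd_i0 n a b (H : b = a + -1) v :
  cyl_bd P bd n H (cyl_i0 V n a v) = oc_i0 P n b (bd n H v).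
Proof. by rewrite /= /cyl_bd_fun /= !linear0 !addr0. Qed.

Let p_cyl_bd n a b (H : b = a + -1) w :
  oc_p P n b (cyl_bd P bd n H w) = bd n H (cyl_p V n a w).
Proof.
case: w => [[x s] y]; rewrite /= /cyl_bd_fun /= linearD linearB /=.
by rewrite oc_p_h subr0 (spc_pi0 (oc_spc P)) (spc_pi1 (oc_spc P)) linearD.
Qed.

Let comp_okBl p q r a b c c' i : comp_ok p q r a b c i -> c' = c + -1 ->
  comp_ok p q r (a + -1) b c' i.
Proof. by case/and3P=> Hi Hr /eqP-> ->; rewrite /comp_ok Hi Hr addrAC eqxx. Qed.

Let comp_okBr p q r a b c c' i : comp_ok p q r a b c i -> c' = c + -1 ->
  comp_ok p q r a (b + -1) c' i.
Proof. by case/and3P=> Hi Hr /eqP-> ->; rewrite /comp_ok Hi Hr addrA eqxx. Qed.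

(** [D] preserves the image of [i0], since the attaching map of the cylinder sends [i0 v] to [i0] of
    the boundary of [v]. *)
Lemma i0p_bd_i0p n (a b : int) (H : b = a + -1) (x : P' n a) :
  D n H (e n a x) = e n b (D n H (e n a x)).
Proof.
move: n a x b H; apply: (free_coproduct_ind P'_coprod).
- by move=> n a d x y Hx Hy b H; rewrite !linearP -Hx -Hy.
- by move=> n a x b H; rewrite e_inP D_inP linear0.
- move=> n a w b H; rewrite e_inIV D_inIV e_inP cyl_bd_i0.
  by rewrite /= (spc_pi0 (oc_spc P)).
- move=> p q r a b c i H x y Hx Hy c' Hc; rewrite (cyl_i0p_map P').2.
  rewrite (D_leibniz erefl erefl Hc H (comp_okBl H Hc) (comp_okBr H Hc)).
  by rewrite linearD linearZ_LR !(cyl_i0p_map P').2 -Hx -Hy !cyl_i0pK.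
Qed.

(** [D] preserves the kernel of [p]: on generators, [p] intertwines the two attaching maps because
    [p h = 0] and [p i0 = p i1 = 1]. *)
Lemma i0p_bd n (a b : int) (H : b = a + -1) (x : P' n a) :
  e n b (D n H x) = e n b (D n H (e n a x)).
Proof.
move: n a x b H; apply: (free_coproduct_ind P'_coprod).
- by move=> n a d x y Hx Hy b H; rewrite !linearP Hx Hy.
- by move=> n a x b H; rewrite e_inP !D_inP.
- move=> n a w b H; rewrite e_inIV !D_inIV !e_inP cyl_bd_i0.
  by rewrite /cyl_i0p /= (spc_pi0 (oc_spc P)); congr (inP _ _ (oc_i0 P _ _ _)); apply: p_cyl_bd.
- move=> p q r a b c i H x y Hx Hy c' Hc; rewrite (cyl_i0p_map P').2.
  have [Kl Kr] := (comp_okBl H Hc, comp_okBr H Hc).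
  rewrite !(D_leibniz erefl erefl Hc H Kl Kr).
  by rewrite !linearD !linearZ_LR !(cyl_i0p_map P').2 Hx Hy !cyl_i0pK.
Qed.

End TwistingDifferential.

Lemma induced_cylinder_derivation : twisted_derivation e (@oc_h k O' P').
Proof.
have [hV [D [hV_tree D_ext]]] := ic_h IC.
apply: perturbed_derivation.
- exact: cyl_i0pK.
- exact: (tree_homotopy_derivation hV_tree).
- by case: D_ext.
- exact: (tree_homotopy_i0p hV_tree).
- exact: (tree_homotopyK hV_tree).
- exact: (i0p_tree_homotopy hV_tree).
- exact: (i0p_bd_i0p D_ext).
- exact: (i0p_bd D_ext).
Qed.

End InducedDerivation.

(** * Induction along the filtration *)

(** The invariant of the transfinite induction; the arity bound is what turns trees into words at
    successors. *)
Definition arity_le1_derivation (k : comPzRingType) (O : dg_operad k) (P : op_cylinder O) :=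
  arity_le1 P /\ twisted_derivation (cyl_i0p P) (@oc_h k O P).

Lemma trivial_cylinder_derivation (k : comPzRingType) (O : dg_operad k) (P : op_cylinder O) :
  initial_dg_operad O -> trivial_cylinder P -> arity_le1_derivation P.
Proof.
move=> [_ O0] [_ i0p h0]; split=> [n a z n1|]; last first.
  by move=> *; rewrite !h0 op_comp0l op_comp0r scaler0 addr0.
have na : (n, a) != (1%N, 0) by rewrite xpair_eqE gtn_eqF.
by rewrite -(i0p _ _ z) (O0 _ _ na (oc_p P n a z)) linear0.
Qed.

(** Any two elements come from one earlier stage, and the stage maps commute with [h], [p], [i0] and
    composition. *)
Lemma limit_cylinder_derivation (k : comPzRingType) (disp : Order.disp_t)
    (W : tbOrderType disp) (F : pseudo_cellular k W) (I : canonical_cylinder F) (c : W) :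
  is_limit c -> (forall b, (b < c)%O -> arity_le1_derivation (I b)) ->
  arity_le1_derivation (I c).
Proof.
move=> c_lim Ib.
have I_surj := colimit_below_surj c_lim.1 (@cc_limit _ _ _ _ I _ c_lim).
split=> [n a z n1|p q r a b d i a' b' d' Ha Hb Hd H H1 H2 x y].
  by have [b [lt_bc [z' ->]]] := I_surj n a z; rewrite ((Ib b lt_bc).1 _ _ z') // linear0.
have [f [lt_fc [x' [y' [-> ->]]]]] : exists f (lt_fc : (f < c)%O) x' y',
    x = sys_map (cc_sys I) (ltW lt_fc) p a x' /\ y = sys_map (cc_sys I) (ltW lt_fc) q b y'.
  have [f [lt_fc [x' Ex]]] := I_surj p a x; have [g [lt_gc [y' Ey]]] := I_surj q b y.
  case: (leP f g) => [le_fg|/ltW le_gf].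
    exists g, lt_gc, (sys_map (cc_sys I) le_fg p a x'), y'; split=> //.
    by rewrite Ex; apply: sys_map_comp.
  exists f, lt_fc, x', (sys_map (cc_sys I) le_gf q b y'); split=> //.
  by rewrite Ey; apply: sys_map_comp.
have sM := (sys_map_dg (cc_sys I) (ltW lt_fc)).1.2.
rewrite -sM !(cc_limit_h lt_fc c_lim) ((Ib f lt_fc).2 _ _ _ _ _ _ _ _ _ _ Ha Hb Hd H H1 H2).
rewrite linearD linearZ_LR /= !sM /= (cc_limit_p lt_fc c_lim) (cc_limit_i0 I lt_fc c_lim).
by [].
Qed.

Lemma canonical_cylinder_derivation (k : comPzRingType) (disp : Order.disp_t)
    (W : tbOrderType disp) (W_wf : well_founded (fun b c : W => (b < c)%O))
    (F : pseudo_cellular k W) (F_abs : absolutely_pseudo_cellular F)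
    (V_arity : forall b : W, (b < \top)%O -> arity_le1 (pc_V F b))
    (I : canonical_cylinder F) (c : W) :
  arity_le1_derivation (I c).
Proof.
elim/(well_founded_ind W_wf): c => c IH.
have [->|c_bot] := pselect (c = \bot%O).
  exact: trivial_cylinder_derivation (cc_bot I).
(* A stage that is neither the bottom nor a successor is a limit; the case split is classical. *)
have [[b bc]|c_lim] := pselect (exists b, is_succ b c); last first.
  by apply: limit_cylinder_derivation IH; split=> // b bc; apply: c_lim; exists b.
have [P1 P_der] := IH b bc.1.
have V1 := V_arity b (lt_le_trans bc.1 (lex1 c)).
have IC := @cc_succ _ _ _ _ I _ _ bc.
split; [exact: arity_le1_induced IC P1 V1|exact: induced_cylinder_derivation IC P1 V1 P_der].
Qed.
Theorem lemma2p21 (k : comPzRingType) (disp : Order.disp_t)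
    (W : tbOrderType disp) (W_wf : well_founded (fun b c : W => (b < c)%O))
    (F : pseudo_cellular k W) (F_abs : absolutely_pseudo_cellular F)
    (V_arity : forall b : W, (b < \top)%O ->
       forall n a (v : pc_V F b n a), (1 < n)%N -> v = 0)
    (I : canonical_cylinder F)
    (n : nat) (a b : int)
    (ok : comp_ok 1 n n a b (a + b) 0)
    (ok1 : comp_ok 1 n n (a + 1) b (a + b + 1) 0)
    (ok2 : comp_ok 1 n n a (b + 1) (a + b + 1) 0)
    (x : F \top%O 1%N a) (y : F \top%O n b) :
  let O := F \top%O in
  let IO := I \top%O in
  let i0 := oc_i0 IO in
  let i1 := oc_i1 IO in
  let h m c : IO m c -> IO m (c + 1) := oc_h IO m erefl in
  h n (a + b) (i1 n (a + b) (op_comp O ok x y)) =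
    op_comp IO ok1 (h 1%N a (i1 1%N a x)) (i1 n b y)
    + ksign k a *: op_comp IO ok2 (i0 1%N a x) (h n b (i1 n b y)).
Proof.
have [_ I_der] := canonical_cylinder_derivation W_wf F_abs V_arity I \top%O.
move=> O IO i0 i1 h.
rewrite /h /i0 /i1 (oc_i1_map IO).1.2.
(* The twisted rule is applied to [i1 x] and [i1 y]; [p i1 = 1] then turns [i0 p (i1 x)] into
   [i0 x]. *)
rewrite (I_der _ _ _ _ _ _ _ _ _ _ erefl erefl erefl ok ok1 ok2).
by rewrite /cyl_i0p /= (spc_pi1 (oc_spc IO)).
Qed.
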